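(* Given an instance $(Q, D, \omega, k)$ of the Aggregate Constraint Repair Problem (user query $Q$, database $D$, aggregate constraint $\omega$, and $k$), each of the two algorithms Full Cluster Filtering (FF) and Cluster Range Pruning (RP), as specified in the context, computes the solution for this problem instance.
   Context: **Setting.** A user query is $Q=\pi_A(\sigma_\theta(R_1\bowtie\dots\bowtie R_l))$ over a database $D$. Only selection conditions change, so the join is materialized and treated as a single relation $R$. The result $Q_{fix}(D)$ of a query with condition $\theta'$ is identified with $\sigma_{\theta'}(R)$. The condition is $\theta=\bigwedge_{i=1}^m (a_i\ \mathrm{op}_i\ c_i)$ with $\mathrm{op}_i\in\{<,>,\le,\ge,=,\ne\}$ for numerical $a_i$ and $\mathrm{op}_i\in\{=,\neq\}$ for categorical $a_i$. Categorical values are encoded as numbers. **Candidates.** A repair candidate is a query $Q_{fix}$ that differs from $Q$ only in the constants of its condition: it has condition $\theta'=\bigwedge_i (a_i\ \mathrm{op}_i\ c_i')$, and is identified with the vector $(c_1',\dots,c_m')$. Only values from the active domain of $a_i$ (the values of $a_i$ occurring in $R$) are considered for $c_i'$. The set of all candidates is $\mathrm{Cand}_Q$. **Constraint.** A filter-aggregation query is $Q^\omega_j=\gamma_{f_j(b_j)}(\sigma_{\theta_j''}(\cdot))$: apply the selection $\theta_j''$ to a collection of tuples and aggregate attribute $b_j$ with $f_j\in\{\mathrm{count},\mathrm{sum},\mathrm{min},\mathrm{max},\mathrm{avg}\}$. An aggregate constraint is $\omega:\ \tau\ \mathrm{op}\ \Phi(Q^\omega_1,\dots,Q^\omega_n)$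 with threshold $\tau$, a comparison operator $\mathrm{op}$, and an arithmetic expression $\Phi$ built with $+,-,\times,/$. A candidate $Q_{fix}$ is a *repair*, written $Q_{fix}(D)\models\omega$, if $\omega$ holds when the $Q_j^\omega$ are evaluated on $Q_{fix}(D)$. **Distance.** $d(Q,Q_{fix})=\sum_i w_i d_i(c_i,c_i')$ with fixed weights $w_i\in[0,1]$, $\sum_i w_i=1$. Here $d_i=|c_i'-c_i|/|c_i|$ for numerical $a_i$. For categorical $a_i$, $d_i=1$ if $c_i\neq c_i'$ and $0$ otherwise. **Aggregate Constraint Repair Problem.** Input: $(Q,D,\omega,k)$. Output (the solution): the $k$ elements $Q_{fix}$ of $\{Q_{fix}\in\mathrm{Cand}_Q: Q_{fix}(D)\models\omega\}$ with the smallest values $d(Q,Q_{fix})$ (ties broken arbitrarily). **kd-tree.** A rooted tree whose nodes ( *clusters* ) are subsets of $R$. The root $C_{root}$ is $R$, the children of an inner node partition it, and each leaf contains a single tuple. Each cluster $C$ stores $\mathrm{bounds}_{a_i}(C)=[\underline a_i,\overline a_i]$ (min and max of $a_i$ in $C$) and $Q_j^\omega(C)$ for each $j$ (sum and count for avg). For sum it also stores $Q_j^{\omega-}(C)$ and $Q_j^{\omega+}(C)$, the sums of the negative, respectively positive, $b_j$-values of tuples in $C$ satisfying $\theta_j''$ (an empty sum is $0$). **Tests.** For an attribute interval $[\underline a,\overline a]$ and a constant interval $[\underline c,\overline c]$: - $\mathrm{reval}_\forall$: for $>$: $\underline a>\overline c$; $\ge$: $\underline a\ge\overline c$; $<$: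 $\overline a<\underline c$; $\le$: $\overline a\le\underline c$; $=$: $\underline a=\underline c=\overline a=\overline c$; $\ne$: $[\underline a,\overline a]\cap[\underline c,\overline c]=\emptyset$. - $\mathrm{reval}_\exists$: for $>$: $\overline a>\underline c$; $\ge$: $\overline a\ge\underline c$; $<$: $\underline a<\overline c$; $\le$: $\underline a\le\overline c$; $=$: $[\underline a,\overline a]\cap[\underline c,\overline c]\ne\emptyset$; $\neq$: $\neg(\underline a=\underline c=\overline c=\overline a)$. - $\mathrm{eval}_\forall(a\ \mathrm{op}\ c,\cdot)$ is $\mathrm{reval}_\forall$ with $\underline c=\overline c=c$. **Algorithm FF.** Enumerate all candidates in increasing order of $d(Q,\cdot)$. For each candidate with condition $\theta'=\bigwedge_i\theta_i'$, compute a cluster set $\mathbf C$ as follows. Start with a stack containing $C_{root}$ and $\mathbf C=\emptyset$. While the stack is nonempty, pop $C$. If $\mathrm{eval}_\forall(\theta_i',\mathrm{bounds}_{a_i}(C))$ is true for all $i$, add $C$ to $\mathbf C$. Otherwise, unless $\mathrm{eval}_\forall(\neg\theta_i',\mathrm{bounds}_{a_i}(C))$ is true for some $i$ (negation is pushed into the operator), push all children of $C$. Then compute each $Q_j^\omega$ by merging the stored values over $C\in\mathbf C$ (summing for sum and count, min for min, max for max, avg from merged sum and count), evaluate $\omega$, and output the candidate if $\omega$ holds. Terminate once $k$ results have been found. **Algorithm RP.** A repair candidate set is a list of intervals $\mathbb Q=[[\underline c_1,\overline c_1],\dots,[\underline c_m,\overline c_m]]$, representing the candidates with $c_i'\in[\underline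 c_i,\overline c_i]$ for all $i$. $\underline{d(Q,\mathbb Q)}$ denotes the lower bound on the distance to $Q$ of any candidate in $\mathbb Q$. *Covering step.* Given $\mathbb Q$, compute $(\mathbf C_{full},\mathbf C_{partial})$, both initially empty, with a stack initialized to $C_{root}$. While the stack is nonempty, pop $C$. Let $in$ (resp. $pin$) be true iff for all $i$, $\mathrm{reval}_\forall$ (resp. $\mathrm{reval}_\exists$) holds for $\mathrm{op}_i$ with attribute interval $\mathrm{bounds}_{a_i}(C)$ and constant interval $[\underline c_i,\overline c_i]$. If $in$, add $C$ to $\mathbf C_{full}$. Else if $pin$, add $C$ to $\mathbf C_{partial}$ if $C$ is a leaf and otherwise push its children. Else discard $C$. *Aggregate bounds* $[\underline{Q_j^\omega},\overline{Q_j^\omega}]$. - min: lower $=\min\{Q_j^\omega(C):C\in\mathbf C_{full}\cup\mathbf C_{partial}\}$, upper $=\min\{Q_j^\omega(C):C\in\mathbf C_{full}\}$. - max: lower $=\max\{Q_j^\omega(C):C\in\mathbf C_{full}\}$, upper $=\max\{Q_j^\omega(C):C\in\mathbf C_{full}\cup\mathbf C_{partial}\}$. - sum: lower $=\sum_{C\in\mathbf C_{full}}Q_j^\omega(C)+\sum_{C\in\mathbf C_{partial}}Q_j^{\omega-}(C)$, upper $=\sum_{C\in\mathbf C_{full}}Q_j^\omega(C)+\sum_{C\in\mathbf C_{partial}}Q_j^{\omega+}(C)$. - count: lower $=\sum_{C\in\mathbf C_{full}}Q_j^\omega(C)$, upper $=\sum_{C\in\mathbf C_{full}\cup\mathbf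 C_{partial}}Q_j^\omega(C)$. - avg: the interval quotient (next paragraph) of the sum bounds by the count bounds. *Interval arithmetic.* Bounds $[\underline\Phi,\overline\Phi]$ are computed from the aggregate bounds by structural recursion on $\Phi$. For $E_1+E_2$: $[\underline{E_1}+\underline{E_2},\overline{E_1}+\overline{E_2}]$. For $E_1-E_2$: $[\underline{E_1}-\overline{E_2},\overline{E_1}-\underline{E_2}]$. For $E_1\times E_2$ and $E_1/E_2$: the min and the max of the operation over the four combinations of endpoints. *Constraint tests.* $\mathrm{aceval}_\forall$ (resp. $\mathrm{aceval}_\exists$) is the result of $\mathrm{reval}_\forall$ (resp. $\mathrm{reval}_\exists$) for the comparison $\tau\ \mathrm{op}\ \Phi$, with attribute interval $[\tau,\tau]$ and constant interval $[\underline\Phi,\overline\Phi]$. *Main loop.* Initialize a priority queue, sorted by $\underline{d(Q,\cdot)}$, with one candidate set covering the whole search space, and let $rcand=\emptyset$. While the queue is nonempty, do the following: 1. Pop the first element $\mathbb Q_{cur}$, and let $\mathbb Q_{next}$ be the element then at the head of the queue (peek). 2. Compute $(\mathbf C_{full},\mathbf C_{partial})$ for $\mathbb Q_{cur}$. 3. If $\mathrm{aceval}_\forall$ is true, insert $\mathbb Q_{cur}$ into $rcand$. Else if $\mathrm{aceval}_\exists$ is true, divide $\mathbb Q_{cur}$ and insert into the queue each resulting candidate set all of whose intervals contain at least one value existing in the data. Otherwise discard $\mathbb Q_{cur}$. 4. Let $\mathcal Q_{top\text{-}k}$ be the $k$ repairs contained in members of $rcand$ with the lowest distance to $Q$ (sorted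 by distance). 5. If $|\mathcal Q_{top\text{-}k}|\ge k$ and $\underline{d(Q,\mathbb Q_{next})}>d(Q,\mathcal Q_{top\text{-}k}[k])$, where $\mathcal Q_{top\text{-}k}[k]$ is the $k$-th element, leave the loop. Return $\mathcal Q_{top\text{-}k}$. *Division.* Each interval $[\underline c_i,\overline c_i]$ is split into a fixed number of fragments ($2$ in the implementation) of roughly the same size. The result consists of all candidate sets obtained by choosing one fragment for each $i$; their union is $\mathbb Q_{cur}$.
   Formalization: For RP, Q_next is read after the fragments of Q_cur are inserted (not peeked in step 1), divisor bounds on the initial candidate set must be ≥ 0 or finite and < 0 (four-corner division is otherwise unsound), and fragments containing data have active-domain endpoints. *)

(* Defs.v *)
From HB Require Import structures.
From mathcomp Require Import all_boot all_order all_algebra.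
From mathcomp Require Import constructive_ereal.

Set Implicit Arguments.
Unset Strict Implicit.
Unset Printing Implicit Defensive.

Import Order.TTheory GRing.Theory Num.Theory.
Local Open Scope ring_scope.

(* Total correctness of a nondeterministic loop: from [s] the loop never gets
   stuck, every execution terminates, and every output satisfies [P]. *)
Inductive computes (S O : Type) (step : S -> S -> Prop) (halt : S -> O -> Prop)
    (P : O -> Prop) (s : S) : Prop :=
  Computes of
    (exists s', step s s') \/ (exists o, halt s o)
  & (forall o, halt s o -> P o)
  & (forall s', step s s' -> computes step halt P s').

(** Comparison operators and interval tests *)

Inductive cmp := CLt | CGt | CLe | CGe | CEq | CNe.

Definition cmp_neg (o : cmp) : cmp :=
  match o with
  | CLt => CGe | CGt => CLe | CLe => CGt | CGe => CLt | CEq => CNe | CNe => CEq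
  end.

Definition cmp_eval d (T : orderType d) (o : cmp) (x y : T) : bool :=
  match o with
  | CLt => (x < y)%O | CGt => (x > y)%O
  | CLe => (x <= y)%O | CGe => (x >= y)%O
  | CEq => x == y | CNe => x != y
  end.

(* A pair [(l, u)] stands for the closed interval [l, u]. *)
Definition itv_meet d (T : orderType d) (I J : T * T) : bool :=
  (Order.max I.1 J.1 <= Order.min I.2 J.2)%O.

Definition reval_all d (T : orderType d) (o : cmp) (a c : T * T) : bool :=
  match o with
  | CGt => (a.1 > c.2)%O
  | CGe => (a.1 >= c.2)%O
  | CLt => (a.2 < c.1)%O
  | CLe => (a.2 <= c.1)%O
  | CEq => [&& a.1 == c.1, c.1 == a.2 & a.2 == c.2]
  | CNe => ~~ itv_meet a c
  end.

Definition reval_ex d (T : orderType d) (o : cmp) (a c : T * T) : bool :=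
  match o with
  | CGt => (a.2 > c.1)%O
  | CGe => (a.2 >= c.1)%O
  | CLt => (a.1 < c.2)%O
  | CLe => (a.1 <= c.2)%O
  | CEq => itv_meet a c
  | CNe => ~~ [&& a.1 == c.1, c.1 == c.2 & c.2 == a.2]
  end.

Definition eval_all d (T : orderType d) (o : cmp) (a : T * T) (c : T) : bool :=
  reval_all o a (c, c).

(** Problem instances *)

Inductive aggfun := Count | Sum | Min | Max | Avg.

(* A filter-aggregation query; [fa_cond] is the selection, a predicate on rows,
   a row being a map from attributes to values. *)
Record filter_agg (R : realFieldType) (attr : Type) := FilterAgg {
  fa_fun  : aggfun;
  fa_attr : attr;
  fa_cond : pred (attr -> R)
}.

Inductive aexpr (R : realFieldType) (n : nat) :=
  | AQuery of 'I_n
  | AConst of R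
  | AAdd of aexpr R n & aexpr R n
  | ASub of aexpr R n & aexpr R n
  | AMul of aexpr R n & aexpr R n
  | ADiv of aexpr R n & aexpr R n.

(* [acr_tup] is the finite type of the tuples of the materialized join; two of
   its elements may carry the same row, so bags are covered as well as sets. *)
Record acr_instance (R : realFieldType) := AcrInstance {
  acr_attr  : Type;
  acr_cat   : pred acr_attr;
  acr_tup   : finType;
  acr_row   : acr_tup -> acr_attr -> R;
  (* the condition of the user query *)
  acr_m     : nat;
  acr_a     : 'I_acr_m -> acr_attr;
  acr_op    : 'I_acr_m -> cmp;
  acr_c     : 'I_acr_m -> R;
  acr_op_ok : forall i, acr_cat (acr_a i) -> acr_op i = CEq \/ acr_op i = CNe;
  (* the aggregate constraint [acr_tau acr_cop acr_phi] *)
  acr_n     : nat;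
  acr_agg   : 'I_acr_n -> filter_agg R acr_attr;
  acr_tau   : R;
  acr_cop   : cmp;
  acr_phi   : aexpr R acr_n;
  (* the weights of the distance *)
  acr_w     : 'I_acr_m -> R;
  acr_w_ok  : forall i, 0 <= acr_w i <= 1;
  acr_w_sum : \sum_i acr_w i = 1;
  acr_k     : nat
}.

(** Extended-real arithmetic.  Aggregates are valued in [\bar R], so that the
    minimum (maximum) over no tuple is +oo (-oo), for queries and for bounds
    alike.  Division is that of [\bar R]: x / 0 is x * +oo, hence 0 / 0 = 0,
    which is in particular the average over no tuple. *)

Fixpoint aexpr_eval (R : realFieldType) n (q : 'I_n -> \bar R)
    (e : aexpr R n) : \bar R :=
  match e with
  | AQuery j => q j
  | AConst x => x%:E
  | AAdd e1 e2 => (aexpr_eval q e1 + aexpr_eval q e2)%E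
  | ASub e1 e2 => (aexpr_eval q e1 - aexpr_eval q e2)%E
  | AMul e1 e2 => (aexpr_eval q e1 * aexpr_eval q e2)%E
  | ADiv e1 e2 => (aexpr_eval q e1 / aexpr_eval q e2)%E
  end.

Section IntervalArithmetic.
Variable R : realFieldType.
Implicit Types I J : \bar R * \bar R.

Definition itv_add I J := (I.1 + J.1, I.2 + J.2)%E.

Definition itv_sub I J := (I.1 - J.2, I.2 - J.1)%E.

Definition itv_corners (f : \bar R -> \bar R -> \bar R) I J :=
  (mine (mine (f I.1 J.1) (f I.1 J.2)) (mine (f I.2 J.1) (f I.2 J.2)),
   maxe (maxe (f I.1 J.1) (f I.1 J.2)) (maxe (f I.2 J.1) (f I.2 J.2))).

Definition itv_mul := itv_corners (fun x y => x * y)%E.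

Definition itv_div := itv_corners (fun x y => x / y)%E.

Fixpoint aexpr_bounds n (q : 'I_n -> \bar R * \bar R) (e : aexpr R n) :=
  match e with
  | AQuery j => q j
  | AConst x => (x%:E, x%:E)
  | AAdd e1 e2 => itv_add (aexpr_bounds q e1) (aexpr_bounds q e2)
  | ASub e1 e2 => itv_sub (aexpr_bounds q e1) (aexpr_bounds q e2)
  | AMul e1 e2 => itv_mul (aexpr_bounds q e1) (aexpr_bounds q e2)
  | ADiv e1 e2 => itv_div (aexpr_bounds q e1) (aexpr_bounds q e2)
  end.

(* The quotient of two intervals is not enclosed by its four corners when 0
   separates values of the divisor: [1,1] / [-1,1] has corners -1 and 1 but
   contains 2.  As 1 / 0 is +oo, the divisor may touch 0 from above. *)
Definition divisor_ok J : bool :=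
  (0 <= J.1)%E || ((-oo < J.1)%E && (J.2 < 0)%E).

Fixpoint divisors_ok n (q : 'I_n -> \bar R * \bar R) (e : aexpr R n) : bool :=
  match e with
  | AQuery _ | AConst _ => true
  | AAdd e1 e2 | ASub e1 e2 | AMul e1 e2 => divisors_ok q e1 && divisors_ok q e2
  | ADiv e1 e2 => [&& divisors_ok q e1, divisors_ok q e2
                    & divisor_ok (aexpr_bounds q e2)]
  end.

End IntervalArithmetic.

(** kd-trees *)

Inductive kdtree (T : finType) := KdNode of {set T} & seq (kdtree T).

Definition kd_cluster (T : finType) (t : kdtree T) : {set T} :=
  let: KdNode C _ := t in C.

Definition kd_children (T : finType) (t : kdtree T) : seq (kdtree T) :=
  let: KdNode _ ch := t in ch.

Definition kd_leaf (T : finType) (t : kdtree T) : bool := nilp (kd_children t).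

Fixpoint kd_wf (T : finType) (t : kdtree T) : bool :=
  let: KdNode C ch := t in
  if ch is [::] then #|C| == 1
  else [&& uniq (map (@kd_cluster T) ch),
           partition [set:: map (@kd_cluster T) ch] C & all (@kd_wf T) ch].

Definition kd_tree_of (T : finType) (t : kdtree T) : Prop :=
  kd_cluster t = [set: T] /\ kd_wf t.

Section Instance.
Variables (R : realFieldType) (P : acr_instance R).

Notation tup := (acr_tup P).
Notation att := (@acr_a R P).
Notation op := (@acr_op R P).

(** The problem *)

(* A query obtained from the user query by changing its constants. *)
Definition candidate := {ffun 'I_(acr_m P) -> R}.

Definition adom (a : acr_attr P) : seq R := [seq acr_row t a | t : tup].

Definition is_candidate (c : candidate) : bool :=
  [forall i, c i \in adom (att i)].

(* The result of the query [c]. *)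
Definition answer (c : candidate) : {set tup} :=
  [set t | [forall i, cmp_eval (op i) (acr_row t (att i)) (c i)]].

Section Aggregates.
Variables (j : 'I_(acr_n P)) (S : {set tup}).

Let b (t : tup) : R := acr_row t (fa_attr (acr_agg j)).

Definition agg_sel : {set tup} := [set t in S | fa_cond (acr_agg j) (acr_row t)].

Definition agg_count : \bar R := (#|agg_sel|%:R)%:E.
Definition agg_sum : \bar R := (\sum_(t in agg_sel) b t)%:E.
Definition agg_sum_neg : \bar R := (\sum_(t in agg_sel | (b t < 0)%R) b t)%:E.
Definition agg_sum_pos : \bar R := (\sum_(t in agg_sel | (0 < b t)%R) b t)%:E.
Definition agg_min : \bar R := \big[mine/+oo%E]_(t in agg_sel) (b t)%:E.
Definition agg_max : \bar R := \big[maxe/-oo%E]_(t in agg_sel) (b t)%:E.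

Definition agg_val : \bar R :=
  match fa_fun (acr_agg j) with
  | Count => agg_count
  | Sum => agg_sum
  | Min => agg_min
  | Max => agg_max
  | Avg => (agg_sum / agg_count)%E
  end.

End Aggregates.

Definition constraint (q : 'I_(acr_n P) -> \bar R) : bool :=
  cmp_eval (acr_cop P) (acr_tau P)%:E (aexpr_eval q (acr_phi P)).

Definition is_repair (c : candidate) : bool :=
  is_candidate c && constraint (fun j => agg_val j (answer c)).

(* With division by 0 being 0, a numerical constant 0 never contributes. *)
Definition dist_at (i : 'I_(acr_m P)) (x : R) : R :=
  if acr_cat (att i) then (acr_c i != x)%:R
  else `|x - acr_c i| / `|acr_c i|.

Definition dist (c : candidate) : R := \sum_i acr_w i * dist_at i (c i).

(* [out] lists the k elements of [A] with the smallest distances (all elements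
   of [A] if there are fewer than k), for some way of breaking ties. *)
Definition k_closest (A : pred candidate) (out : seq candidate) : Prop :=
  [/\ uniq out,
      all A out,
      (size out <= acr_k P)%N,
      (size out < acr_k P)%N -> (forall c, A c -> c \in out)
    & forall c c', c \in out -> A c' -> c' \notin out -> dist c <= dist c'].

Definition solution (out : seq candidate) : Prop := k_closest is_repair out.

Definition bounds (a : acr_attr P) (C : {set tup}) : \bar R * \bar R :=
  (\big[mine/+oo%E]_(t in C) (acr_row t a)%:E,
   \big[maxe/-oo%E]_(t in C) (acr_row t a)%:E).

(** Full cluster filtering *)

Section FullClusterFiltering.
Variable root : kdtree tup.

(* One turn of the loop; the state is (stack, clusters found). *)
Definition ff_visit (c : candidate) (s : seq (kdtree tup) * seq {set tup}) :=
  let: (stack, Cs) := s in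
  if stack is t :: stack' then
    let C := kd_cluster t in
    if [forall i, eval_all (op i) (bounds (att i) C) (c i)%:E] then
      (stack', C :: Cs)
    else if [exists i, eval_all (cmp_neg (op i)) (bounds (att i) C) (c i)%:E]
    then (stack', Cs)
    else (kd_children t ++ stack', Cs)
  else s.

Definition ff_clusters (c : candidate) (Cs : seq {set tup}) : Prop :=
  exists N, iter N (ff_visit c) ([:: root], [::]) = ([::], Cs).

Definition agg_merge (Cs : seq {set tup}) (j : 'I_(acr_n P)) : \bar R :=
  match fa_fun (acr_agg j) with
  | Count => (\sum_(C <- Cs) agg_count j C)%E
  | Sum => (\sum_(C <- Cs) agg_sum j C)%E
  | Min => \big[mine/+oo%E]_(C <- Cs) agg_min j C
  | Max => \big[maxe/-oo%E]_(C <- Cs) agg_max j C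
  | Avg => ((\sum_(C <- Cs) agg_sum j C) / (\sum_(C <- Cs) agg_count j C))%E
  end.

Definition ff_order (cs : seq candidate) : Prop :=
  [/\ uniq cs, cs =i is_candidate & sorted (fun c c' => dist c <= dist c') cs].

(* The state is (candidates still to be tried, output so far). *)
Definition ff_state : Type := seq candidate * seq candidate.

Inductive ff_step : ff_state -> ff_state -> Prop :=
  FFStep c cs out Cs of (size out < acr_k P)%N & ff_clusters c Cs :
    ff_step (c :: cs, out)
            (cs, if constraint (agg_merge Cs) then rcons out c else out).

Inductive ff_halt : ff_state -> seq candidate -> Prop :=
  | FFExhausted out : ff_halt ([::], out) out
  | FFEnough cs out of (acr_k P <= size out)%N : ff_halt (cs, out) out.

End FullClusterFiltering.

(** Cluster range pruning *)

Definition cset := {ffun 'I_(acr_m P) -> R * R}.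

Definition in_itv (I : R * R) (x : R) : bool := I.1 <= x <= I.2.

Definition in_cset (Q : cset) (c : candidate) : bool :=
  [forall i, in_itv (Q i) (c i)].

Definition cset_root : cset :=
  [ffun i => (fine (bounds (att i) [set: tup]).1,
              fine (bounds (att i) [set: tup]).2)].

Definition cset_has_data (Q : cset) : bool :=
  [forall i, has (in_itv (Q i)) (adom (att i))].

(* Any lower bound on the distance is allowed, not just the greatest one. *)
Definition dist_lower_bound (dlow : cset -> R) : Prop :=
  forall Q c, is_candidate c -> in_cset Q c -> dlow Q <= dist c.

(* [split i I] cuts [I] into [p] fragments, which represent each active-domain
   value of [I] exactly once; surplus fragments contain no such value.  Only
   active-domain values matter, so they are taken as the endpoints.  Of the
   requirement that the fragments be of roughly the same size, only one
   consequence is kept: an interval with at least two values is not left whole.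
   It holds both for fragments of equal cardinality and of equal width. *)
Definition is_split p (split : 'I_(acr_m P) -> R * R -> p.-tuple (R * R)) : Prop :=
  forall i (I : R * R),
    I.1 \in adom (att i) -> I.2 \in adom (att i) -> I.1 <= I.2 ->
  [/\ forall x, x \in adom (att i) ->
        count (fun J => in_itv J x) (split i I) = in_itv I x,
      forall J, J \in split i I -> has (in_itv J) (adom (att i)) ->
        J.1 \in adom (att i) /\ J.2 \in adom (att i)
    & I.1 < I.2 -> forall J, J \in split i I ->
        exists2 x, x \in adom (att i) & in_itv I x && ~~ in_itv J x].

Section ClusterRangePruning.
Variables (root : kdtree tup) (p : nat).
Variable split : 'I_(acr_m P) -> R * R -> p.-tuple (R * R).
Variable dlow : cset -> R.

Definition divide (Q : cset) : seq cset :=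
  [seq [ffun i => tnth (split i (Q i)) (f i)] | f : {ffun 'I_(acr_m P) -> 'I_p}].

Definition itvE (I : R * R) : \bar R * \bar R := (I.1%:E, I.2%:E).

(* One turn of the loop; the state is (stack, full, partial). *)
Definition rp_visit (Q : cset)
    (s : seq (kdtree tup) * seq {set tup} * seq {set tup}) :=
  let: (stack, full, part) := s in
  if stack is t :: stack' then
    let C := kd_cluster t in
    if [forall i, reval_all (op i) (bounds (att i) C) (itvE (Q i))] then
      (stack', C :: full, part)
    else if [forall i, reval_ex (op i) (bounds (att i) C) (itvE (Q i))] then
      if kd_leaf t then (stack', full, C :: part)
      else (kd_children t ++ stack', full, part)
    else (stack', full, part)
  else s.

Definition rp_clusters (Q : cset) (full part : seq {set tup}) : Prop :=
  exists N, iter N (rp_visit Q) ([:: root], [::], [::]) = ([::], full, part).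

Section Bounds.
Variables full part : seq {set tup}.

Definition sum_bounds (j : 'I_(acr_n P)) : \bar R * \bar R :=
  (\sum_(C <- full) agg_sum j C + \sum_(C <- part) agg_sum_neg j C,
   \sum_(C <- full) agg_sum j C + \sum_(C <- part) agg_sum_pos j C)%E.

Definition count_bounds (j : 'I_(acr_n P)) : \bar R * \bar R :=
  (\sum_(C <- full) agg_count j C, \sum_(C <- full ++ part) agg_count j C)%E.

Definition agg_bounds (j : 'I_(acr_n P)) : \bar R * \bar R :=
  match fa_fun (acr_agg j) with
  | Count => count_bounds j
  | Sum => sum_bounds j
  | Min => (\big[mine/+oo%E]_(C <- full ++ part) agg_min j C,
            \big[mine/+oo%E]_(C <- full) agg_min j C)
  | Max => (\big[maxe/-oo%E]_(C <- full) agg_max j C,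
            \big[maxe/-oo%E]_(C <- full ++ part) agg_max j C)
  | Avg => itv_div (sum_bounds j) (count_bounds j)
  end.

Definition phi_bounds : \bar R * \bar R := aexpr_bounds agg_bounds (acr_phi P).

Definition aceval_all : bool :=
  reval_all (acr_cop P) ((acr_tau P)%:E, (acr_tau P)%:E) phi_bounds.

Definition aceval_ex : bool :=
  reval_ex (acr_cop P) ((acr_tau P)%:E, (acr_tau P)%:E) phi_bounds.

End Bounds.

(* On the whole search space, the bounds computed for a divisor of the
   arithmetic expression do not straddle 0. *)
Definition rp_divisors_ok : Prop :=
  forall full part, rp_clusters cset_root full part ->
    divisors_ok (agg_bounds full part) (acr_phi P).

Definition enqueue (q new q' : seq cset) : Prop :=
  perm_eq q' (q ++ new) /\ sorted (fun Q Q' => dlow Q <= dlow Q') q'.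

(* Processing of the element [Q] popped from the queue, the rest of which is
   [q]; the other arguments are rcand and the resulting queue and rcand. *)
Inductive rp_process (Q : cset) (q rcand : seq cset) :
    seq cset -> seq cset -> Prop :=
  | RPAccept full part of rp_clusters Q full part
      & aceval_all full part :
      rp_process Q q rcand q (Q :: rcand)
  | RPDivide full part q' of rp_clusters Q full part
      & ~~ aceval_all full part & aceval_ex full part
      & enqueue q [seq Q' <- divide Q | cset_has_data Q'] q' :
      rp_process Q q rcand q' rcand
  | RPDiscard full part of rp_clusters Q full part
      & ~~ aceval_all full part & ~~ aceval_ex full part :
      rp_process Q q rcand q rcand.

Definition rp_top_k (rcand : seq cset) (top : seq candidate) : Prop :=
  k_closest (fun c => is_candidate c && has (in_cset^~ c) rcand) top /\
  sorted (fun c c' => dist c <= dist c') top.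

(* The exit test, for the queue [q] at the time of the test.  The head must be
   read after the insertions of the current iteration: a candidate set that has
   just been inserted may be closer than everything queued before it, and would
   be lost.  With an empty queue the loop ends anyway. *)
Definition rp_leave (q : seq cset) (top : seq candidate) : bool :=
  if q is Qnext :: _ then
    (acr_k P <= size top)%N &&
    (nth 0 (map dist top) (acr_k P).-1 < dlow Qnext)
  else false.

(* The state is (queue, rcand, current top-k). *)
Definition rp_state : Type := seq cset * seq cset * seq candidate.

Definition rp_init : rp_state := ([:: cset_root], [::], [::]).

Inductive rp_step : rp_state -> rp_state -> Prop :=
  RPStep Q q rcand top q' rcand' top' of
      rp_process Q q rcand q' rcand' & rp_top_k rcand' top'
    & ~~ rp_leave q' top' :
    rp_step (Q :: q, rcand, top) (q', rcand', top').

Inductive rp_halt : rp_state -> seq candidate -> Prop :=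
  | RPEmpty rcand top : rp_halt ([::], rcand, top) top
  | RPLeave Q q rcand top q' rcand' top' of
      rp_process Q q rcand q' rcand' & rp_top_k rcand' top'
    & rp_leave q' top' :
    rp_halt (Q :: q, rcand, top) top'.

End ClusterRangePruning.

End Instance.

(* Main.v *)
(* All that matters about a traversal is which tuples its clusters cover, each
   exactly once.  FF's clusters tile the answer.  RP's full clusters tile a set
   [surely Q] of tuples selected by every candidate in [Q], and its full and
   partial clusters together tile a set [possibly Q] containing every tuple
   selected by some candidate in [Q].  The aggregate bounds are determined by
   these two sets and shrink when [Q] does; they are exact on a degenerate [Q],
   that is, on a single candidate.  Interval arithmetic is inclusion monotone
   wherever divisors do not straddle 0, so the tests of RP are sound; they agree
   on degenerate sets, hence these are never divided and division terminates.
   On an early exit every queued candidate is at least as far as the head of the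
   queue, hence farther than the k-th repair found. *)

Require Import Defs.
From mathcomp Require Import all_boot all_order all_algebra.
From mathcomp Require Import constructive_ereal.

Set Implicit Arguments.
Unset Strict Implicit.
Unset Printing Implicit Defensive.

Import Order.TTheory GRing.Theory Num.Theory.

Local Open Scope ring_scope.

(** * Nested intervals and interval tests *)

(** [I] has to be nonempty: only then does the equality test survive shrinking, and only then do
    both endpoints of [I] lie within [J]. *)
Definition nested d (T : orderType d) (I J : T * T) : bool :=
  [&& J.1 <= I.1, I.1 <= I.2 & I.2 <= J.2]%O.

Section Tests.
Context d (T : orderType d).
Implicit Types (o : cmp) (a c I J : T * T) (u v w : T).

Lemma nested_refl I : (I.1 <= I.2)%O -> nested I I.
Proof. by rewrite /nested !lexx => ->. Qed.

(** Membership is inclusion of a degenerate interval, so monotonicity lemmas also yield soundness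
    for single values. *)
Lemma nested_point v I : nested (v, v) I = (I.1 <= v <= I.2)%O.
Proof. by rewrite /nested lexx. Qed.

Lemma nested_diag v : nested (v, v) (v, v).
Proof. by rewrite nested_point !lexx. Qed.

Lemma nested_within I J v :
  nested I J -> (I.1 <= v <= I.2)%O -> (J.1 <= v <= J.2)%O.
Proof.
move=> /and3P[h1 _ h3] /andP[h4 h5].
by rewrite (le_trans h1 h4) (le_trans h5 h3).
Qed.

Lemma cmp_eval_neg o u v : cmp_eval (cmp_neg o) u v = ~~ cmp_eval o u v.
Proof. by case: o => /=; rewrite ?leNgt ?ltNge ?negbK. Qed.

Lemma itv_meet_point u v : Defs.itv_meet (u, u) (v, v) = (u == v).
Proof. by rewrite /Defs.itv_meet ge_max !le_min !lexx /= andbT eq_le. Qed.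

Lemma reval_all_point o u v : reval_all o (u, u) (v, v) = cmp_eval o u v.
Proof.
case: o => //=; last by rewrite itv_meet_point.
by rewrite [v == u]eq_sym; case: eqP.
Qed.

Lemma reval_ex_point o u v : reval_ex o (u, u) (v, v) = cmp_eval o u v.
Proof.
case: o => //=; first by rewrite itv_meet_point.
by rewrite eqxx [v == u]eq_sym; case: eqP.
Qed.

Lemma itv_meet_nested a a' c c' :
  nested a' a -> nested c' c -> Defs.itv_meet a' c' -> Defs.itv_meet a c.
Proof.
move=> /and3P[h1 _ h3] /and3P[h4 _ h6].
rewrite /Defs.itv_meet !ge_max !le_min -!andbA => /and4P[g1 g2 g3 g4].
have ha := le_trans h1 (le_trans g1 h3).
have hc := le_trans h4 (le_trans g4 h6).
by rewrite ha hc (le_trans h1 (le_trans g2 h6)) (le_trans h4 (le_trans g3 h3)).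
Qed.

(** An order test compares facing endpoints, which shrinking moves apart. The equality test forces
    both intervals to be the same point, and a nonempty subinterval is that point again. *)
Lemma reval_all_nested o a a' c c' : nested a' a -> nested c' c ->
  reval_all o a c -> reval_all o a' c'.
Proof.
move=> na nc; have /and3P[h1 h2 h3] := na; have /and3P[h4 h5 h6] := nc.
case: o => /=.
- by move=> h; exact: le_lt_trans h3 (lt_le_trans h h4).
- by move=> h; exact: le_lt_trans h6 (lt_le_trans h h1).
- by move=> h; exact: le_trans h3 (le_trans h h4).
- by move=> h; exact: le_trans h6 (le_trans h h1).
- move=> /and3P[/eqP e1 /eqP e2 /eqP e3].
  have eq_between w I J :
      nested I J -> J.1 = w -> J.2 = w -> I.1 = w /\ I.2 = w.
    case/and3P=> g1 g2 g3 E1 E2; rewrite E1 in g1; rewrite E2 in g3.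
    split; apply/eqP; rewrite eq_le.
      by rewrite g1 (le_trans g2 g3).
    by rewrite g3 (le_trans g1 g2).
  have [-> ->] := eq_between a.1 _ _ na erefl (esym (etrans e1 e2)).
  have [-> ->] := eq_between a.1 _ _ nc (esym e1)
                    (esym (etrans e1 (etrans e2 e3))).
  by rewrite eqxx.
- by apply: contra; exact: itv_meet_nested.
Qed.

Lemma reval_ex_nested o a a' c c' : nested a' a -> nested c' c ->
  reval_ex o a' c' -> reval_ex o a c.
Proof.
move=> na nc; have /and3P[h1 h2 h3] := na; have /and3P[h4 h5 h6] := nc.
case: o => /=.
- by move=> h; exact: le_lt_trans h1 (lt_le_trans h h6).
- by move=> h; exact: le_lt_trans h4 (lt_le_trans h h3).
- by move=> h; exact: le_trans h1 (le_trans h h6).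
- by move=> h; exact: le_trans h4 (le_trans h h3).
- exact: itv_meet_nested.
(* For [CNe], the negated test is the universal equality test with its equations reordered, which
   survives shrinking. *)
apply: contra => /and3P[/eqP e1 /eqP e2 /eqP e3].
have : reval_all CEq a c by rewrite /= e1 e2 e3 !eqxx.
move=> /(reval_all_nested na nc) /and3P[/eqP -> /eqP e4 /eqP e5].
by rewrite -e4 -e5 -e4 !eqxx.
Qed.

(** Shrink both intervals to their lower endpoints, where the two tests coincide, then enlarge
    again. *)
Lemma reval_all_ex o a c :
  (a.1 <= a.2)%O -> (c.1 <= c.2)%O -> reval_all o a c -> reval_ex o a c.
Proof.
move=> ha hc.
have na : nested (a.1, a.1) a by rewrite nested_point lexx ha.
have nc : nested (c.1, c.1) c by rewrite nested_point lexx hc.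
move=> /(reval_all_nested na nc); rewrite reval_all_point -reval_ex_point.
exact: reval_ex_nested.
Qed.

End Tests.

Lemma cmp_eval_EFin (R : realFieldType) o (x y : R) :
  cmp_eval o x%:E y%:E = cmp_eval o x y.
Proof. by case: o => /=; rewrite ?lee_fin ?lte_fin ?eqe. Qed.

(** * Interval arithmetic *)

Section IntervalArithmeticTheory.
Variable R : realFieldType.
Implicit Types (x y u v : \bar R) (I J : \bar R * \bar R).

Lemma itv_add_nested I I' J J' :
  nested I' I -> nested J' J -> nested (itv_add I' J') (itv_add I J).
Proof.
by move=> /and3P[h1 h2 h3] /and3P[h4 h5 h6]; rewrite /nested /= !leeD.
Qed.

Lemma itv_sub_nested I I' J J' :
  nested I' I -> nested J' J -> nested (itv_sub I' J') (itv_sub I J).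
Proof.
by move=> /and3P[h1 h2 h3] /and3P[h4 h5 h6]; rewrite /nested /= !leeB.
Qed.

Lemma mule_between x y u v : (u <= x <= v)%E ->
  (mine (u * y) (v * y) <= x * y <= maxe (u * y) (v * y))%E.
Proof.
move=> /andP[ux xv]; rewrite ge_min le_max.
have [y0|/ltW y0] := leP 0%E y.
  by rewrite (lee_wpmul2r y0 ux) (lee_wpmul2r y0 xv) orbT.
(* For [y <= 0], negating both sides reduces the claim to the nonnegative factor [- y]. *)
have anti z t : (z <= t)%E -> (t * y <= z * y)%E.
  by move=> zt; rewrite -leeN2 -!muleN lee_wpmul2r // oppe_ge0.
by rewrite (anti _ _ ux) (anti _ _ xv) orbT.
Qed.

Lemma mule_corners x y I J : (I.1 <= x <= I.2)%E -> (J.1 <= y <= J.2)%E ->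
  ((itv_mul I J).1 <= x * y <= (itv_mul I J).2)%E.
Proof.
move=> hx hy; have /andP[l u] := mule_between y hx.
have := mule_between I.1 hy; have := mule_between I.2 hy.
rewrite ![(_ * I.1)%E]muleC ![(_ * I.2)%E]muleC => /andP[l2 u2] /andP[l1 u1].
apply/andP; split; rewrite /itv_mul /itv_corners /=.
  apply: le_trans l; rewrite le_min; apply/andP; split.
    by rewrite ge_min l1.
  by rewrite ge_min l2 orbT.
apply: (le_trans u); rewrite ge_max; apply/andP; split.
  by rewrite le_max u1.
by rewrite le_max u2 orbT.
Qed.

(** An admissible divisor lies either in [0, +oo], where inversion with 1 / 0 = +oo is antitone, or
    among the finite negative numbers, where inversion is that of the field. *)
Lemma inve_anti J x y : divisor_ok J -> (J.1 <= x)%E -> (x <= y)%E ->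
  (y <= J.2)%E -> (y^-1 <= x^-1)%E.
Proof.
move=> /orP[J0|/andP[J1 J2]] Jx xy yJ.
  have x0 := le_trans J0 Jx; have y0 := le_trans x0 xy.
  by rewrite lee_pV2 // inE.
have := lt_le_trans J1 Jx; have := le_lt_trans yJ J2.
move: x y xy {Jx yJ} => [x||] [y||] //; rewrite !lte_fin lee_fin => xy y0 _.
have x0 := le_lt_trans xy y0.
by rewrite !inver !lt_eqF // lee_fin lef_nV2 ?inE.
Qed.

Lemma dive_corners x y I J : divisor_ok J ->
  (I.1 <= x <= I.2)%E -> (J.1 <= y <= J.2)%E ->
  ((itv_div I J).1 <= x / y <= (itv_div I J).2)%E.
Proof.
move=> okJ hx /andP[Jy yJ].
have hy : (J.2^-1 <= y^-1 <= J.1^-1)%E.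
  by rewrite (inve_anti okJ Jy yJ) // (inve_anti okJ _ Jy yJ).
(* A quotient is a product with the inverse, whose interval has swapped endpoints; this only
   reorders the corners. *)
have := @mule_corners x y^-1 I (J.2^-1, J.1^-1)%E hx hy.
rewrite /itv_div /itv_mul /itv_corners /=.
by rewrite minC (minC (_ * _)%E) [X in mine _ X]minC maxC (maxC (_ * _)%E)
           [X in maxe _ X]maxC minC maxC.
Qed.

(** Corners are values of [f] at endpoints of [I'] and [J'], so inclusion monotonicity reduces to
    enclosing the values of [f]. *)
Lemma itv_corners_sub (f : \bar R -> \bar R -> \bar R) I' J' (lo up : \bar R) :
  (forall x y, (I'.1 <= x <= I'.2)%E -> (J'.1 <= y <= J'.2)%E ->
     (lo <= f x y <= up)%E) ->
  (I'.1 <= I'.2)%E -> (J'.1 <= J'.2)%E ->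
  nested (itv_corners f I' J') (lo, up).
Proof.
move=> fP hI hJ.
have /andP[l1 u1] : (lo <= f I'.1 J'.1 <= up)%E by rewrite fP ?lexx.
have /andP[l2 u2] : (lo <= f I'.1 J'.2 <= up)%E by rewrite fP ?lexx ?andbT.
have /andP[l3 u3] : (lo <= f I'.2 J'.1 <= up)%E by rewrite fP ?lexx ?andbT.
have /andP[l4 u4] : (lo <= f I'.2 J'.2 <= up)%E by rewrite fP ?lexx ?andbT.
apply/and3P; split; rewrite /itv_corners /=.
- by rewrite !le_min l1 l2 l3.
- by rewrite !(ge_min, le_max) lexx.
- by rewrite !ge_max u1 u2 u3.
Qed.

Lemma itv_mul_nested I I' J J' :
  nested I' I -> nested J' J -> nested (itv_mul I' J') (itv_mul I J).
Proof.
move=> nI nJ; have /and3P[_ hI _] := nI; have /and3P[_ hJ _] := nJ.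
rewrite [itv_mul I J]surjective_pairing; apply: itv_corners_sub => // x y hx hy.
by apply: mule_corners; [exact: nested_within hx | exact: nested_within hy].
Qed.

Lemma itv_div_nested I I' J J' : divisor_ok J ->
  nested I' I -> nested J' J -> nested (itv_div I' J') (itv_div I J).
Proof.
move=> okJ nI nJ; have /and3P[_ hI _] := nI; have /and3P[_ hJ _] := nJ.
rewrite [itv_div I J]surjective_pairing; apply: itv_corners_sub => // x y hx hy.
by apply: dive_corners; [|exact: nested_within hx | exact: nested_within hy].
Qed.

Lemma itv_corners_point f x y : itv_corners f (x, x) (y, y) = (f x y, f x y).
Proof. by rewrite /itv_corners /= !minxx !maxxx. Qed.

Lemma divisor_ok_nested I J : nested I J -> divisor_ok J -> divisor_ok I.
Proof.
move=> /and3P[h1 _ h3] /orP[h|/andP[h h']]; apply/orP.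
  by left; exact: le_trans h h1.
by right; rewrite (lt_le_trans h h1) (le_lt_trans h3 h').
Qed.

(** The conclusions are proved together: at a quotient, nesting of the divisor's bounds carries the
    divisor condition to the narrower bounds. *)
Lemma aexpr_bounds_nested n (q q' : 'I_n -> \bar R * \bar R) (e : aexpr R n) :
  (forall j, nested (q' j) (q j)) -> divisors_ok q e ->
  nested (aexpr_bounds q' e) (aexpr_bounds q e) /\ divisors_ok q' e.
Proof.
move=> nq; elim: e => [j|x|e1 IH1 e2 IH2|e1 IH1 e2 IH2|e1 IH1 e2 IH2
                      |e1 IH1 e2 IH2] /=.
- by [].
- by rewrite /nested /= !lexx.
- move=> /andP[/IH1[n1 ->] /IH2[n2 ->]]; split=> //; exact: itv_add_nested.
- move=> /andP[/IH1[n1 ->] /IH2[n2 ->]]; split=> //; exact: itv_sub_nested.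
- move=> /andP[/IH1[n1 ->] /IH2[n2 ->]]; split=> //; exact: itv_mul_nested.
move=> /and3P[/IH1[n1 ->] /IH2[n2 ->] ok]; split.
  exact: itv_div_nested.
exact: divisor_ok_nested ok.
Qed.

Lemma aexpr_bounds_point n (q : 'I_n -> \bar R) (e : aexpr R n) :
  aexpr_bounds (fun j => (q j, q j)) e = (aexpr_eval q e, aexpr_eval q e).
Proof.
by elim: e => //= e1 -> e2 ->; rewrite ?/itv_mul ?/itv_div ?itv_corners_point.
Qed.

Lemma eq_aexpr_bounds n (q q' : 'I_n -> \bar R * \bar R) (e : aexpr R n) :
  q =1 q' -> aexpr_bounds q e = aexpr_bounds q' e.
Proof. by move=> qq'; elim: e => //= e1 -> e2 ->. Qed.

Lemma eq_aexpr_eval n (q q' : 'I_n -> \bar R) (e : aexpr R n) :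
  q =1 q' -> aexpr_eval q e = aexpr_eval q' e.
Proof. by move=> qq'; elim: e => //= e1 -> e2 ->. Qed.

Lemma eq_divisors_ok n (q q' : 'I_n -> \bar R * \bar R) (e : aexpr R n) :
  q =1 q' -> divisors_ok q e = divisors_ok q' e.
Proof.
move=> qq'; elim: e => //= e1 -> e2 -> //.
by rewrite (eq_aexpr_bounds e2 qq').
Qed.

End IntervalArithmeticTheory.

(** * Families of disjoint sets and tree traversals *)

Section Tiles.
Variable T : finType.
Implicit Types (Cs : seq {set T}) (C S : {set T}).

(** One counting equation expresses both disjointness, repetitions in the list included, and the
    union being [S]. *)
Definition tiles Cs S : Prop :=
  forall x, count (fun C => x \in C) Cs = (x \in S).

Lemma tiles_partition Cs C : uniq Cs -> partition [set:: Cs] C -> tiles Cs C.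
Proof.
move=> uCs /and3P[/eqP covC triv _] x; rewrite -covC.
have [xC|xC] := boolP (x \in cover [set:: Cs]).
  have pC := pblock_mem xC; rewrite inE in pC.
  rewrite -[RHS]/(true : nat) -pC -(count_uniq_mem _ uCs).
  apply: eq_in_count => D DCs /=; apply/idP/eqP => [xD|->].
    by rewrite (def_pblock triv _ xD) ?inE.
  by rewrite mem_pblock.
apply/eqP; rewrite -leqn0 leqNgt -has_count.
apply: contra xC => /hasP[D DCs xD].
by apply/bigcupP; exists D; rewrite ?inE.
Qed.

Lemma tiles_rev Cs S : tiles Cs S -> tiles (rev Cs) S.
Proof. by move=> h x; rewrite count_rev. Qed.

(** After exchanging the two iterations, [g x] is taken once for each member containing [x], hence
    once or not at all. *)
Lemma big_tiles (V : Type) (idx : V) (op : Monoid.com_law idx) Cs S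
    (p : pred T) (g : T -> V) : tiles Cs S ->
  \big[op/idx]_(C <- Cs) \big[op/idx]_(x in C | p x) g x =
  \big[op/idx]_(x in S | p x) g x.
Proof.
move=> tCs; under eq_bigr do rewrite big_andbC big_mkcondr.
rewrite exchange_big /= [RHS]big_andbC [RHS]big_mkcondr.
apply: eq_bigr => x _; rewrite -big_mkcond big_const_seq tCs.
by case: ifP => //= _; rewrite Monoid.mulm1.
Qed.

End Tiles.

(** * kd-trees and the subtrees at which a traversal stops *)

Section KdTrees.
Variable T : finType.
Implicit Types (t : kdtree T) (C S : {set T}).

(** The children sit in a list, so the generated principle gives no hypothesis on them; the [foldr]
    conjunction supplies one per child. *)
Lemma kdtree_nested_ind (P : kdtree T -> Prop) :
  (forall C ch, foldr (fun t => and (P t)) True ch -> P (KdNode C ch)) ->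
  forall t, P t.
Proof.
move=> IH; fix IHt 1; case=> C ch; apply: IH.
by elim: ch => [|t ch IHch] //=; split.
Qed.

Lemma kd_wf_leaf t : kd_wf t -> kd_leaf t -> exists x, kd_cluster t = [set x].
Proof. by case: t => C [|//] /cards1P[x ->] _; exists x. Qed.

Lemma kd_wf_nonempty t : kd_wf t -> exists x, x \in kd_cluster t.
Proof.
case: t => C [/cards1P[x ->]|t ch /and3P[_ /and3P[/eqP <- _ n0] _]].
  by exists x; rewrite /= inE.
have tP : kd_cluster t \in [set:: map (@kd_cluster T) (t :: ch)].
  by rewrite inE /= mem_head.
have /set0Pn[x xt] : kd_cluster t != set0.
  by apply: contra n0 => /eqP <-.
by exists x; apply/bigcupP; exists (kd_cluster t).
Qed.

Variable descend : pred (kdtree T).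

(** Abstracting the decision to open a node lets one analysis serve the stack loops of both
    algorithms. *)
Fixpoint terminals t : seq (kdtree T) :=
  let: KdNode C ch := t in
  if descend (KdNode C ch) then flatten (map terminals ch) else [:: t].

(** Where the traversal stops, the test [a] settles membership in [S] for the whole cluster; above,
    the children partition their parent, so counts add up. *)
Lemma tiles_terminals (a : pred (kdtree T)) S :
  (forall t, descend t -> ~~ kd_leaf t) ->
  (forall t, kd_wf t -> ~~ descend t ->
     forall x, x \in kd_cluster t -> a t = (x \in S)) ->
  forall t, kd_wf t ->
    tiles [seq kd_cluster u | u <- terminals t & a u] (kd_cluster t :&: S).
Proof.
move=> inner aS; elim/kdtree_nested_ind => C ch IH wf x.
rewrite [terminals _]/=; case: ifP => [dsc|/negbT ndsc]; last first.
  rewrite /= inE; have := aS _ wf ndsc x.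
  by case: ifP => _ /=; case: (x \in C) => //= /(_ isT) <-.
have tC : tiles (map (@kd_cluster T) ch) C.
  case: ch wf dsc {IH} => [_ /inner //|t ch /and3P[u p _] _].
  exact: tiles_partition.
have {}wf : all (@kd_wf T) ch.
  by case: ch wf dsc {IH tC} => [_ /inner //|t ch /and3P[_ _]].
(* As a product, the membership distributes over the sum of counts of the children. *)
have -> : (x \in kd_cluster (KdNode C ch) :&: S : nat)
          = ((x \in C) * (x \in S))%N by rewrite inE mulnb.
rewrite -tC; elim: ch wf IH {dsc tC} => //= t ch IHch /andP[wt wch] [IHt IH].
rewrite filter_cat map_cat count_cat (IHt wt) IHch // inE mulnDl.
by rewrite mulnb.
Qed.

Section Machine.
Variables (A St : Type) (mk : seq (kdtree T) -> A -> St).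
Variables (upd : A -> kdtree T -> A) (visit : St -> St).
Hypothesis mk_inj : forall st a b, mk st a = mk st b -> a = b.
Hypothesis visit_nil : forall a, visit (mk [::] a) = mk [::] a.
Hypothesis visit_cons : forall t st a, visit (mk (t :: st) a) =
  if descend t then mk (kd_children t ++ st) a else mk st (upd a t).

(** The loop is depth-first: it finishes a subtree before touching the rest [st] of the stack, which
    must be arbitrary for the induction. *)
Lemma iter_visit_exists t st a :
  exists N, iter N visit (mk (t :: st) a) = mk st (foldl upd a (terminals t)).
Proof.
elim/kdtree_nested_ind: t st a => C ch IH st a.
rewrite [terminals _]/=.
case: (boolP (descend (KdNode C ch))) => dsc; last first.
  by exists 1%N; rewrite /= visit_cons (negbTE dsc).
suff [N hN] : exists N, iter N visit (mk (ch ++ st) a) =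
                 mk st (foldl upd a (flatten (map terminals ch))).
  by exists N.+1; rewrite iterSr visit_cons dsc.
elim: ch a IH {dsc} => [|t ch IHch] a /=; first by exists 0%N.
move=> [IHt IH]; have [N hN] := IHt (ch ++ st) a.
have [M hM] := IHch (foldl upd a (terminals t)) IH.
by exists (M + N)%N; rewrite iterD hN hM foldl_cat.
Qed.

(** States with an empty stack are fixed, so two runs that empty the stack agree once both have been
    run long enough. *)
Lemma iter_visit t a b :
  (exists N, iter N visit (mk [:: t] a) = mk [::] b) <->
  b = foldl upd a (terminals t).
Proof.
split=> [[N hN]|->]; last exact: iter_visit_exists.
have [M hM] := iter_visit_exists t [::] a.
have fixed K c : iter K visit (mk [::] c) = mk [::] c.
  by elim: K => //= K ->.
apply: (mk_inj (st := [::])).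
by rewrite -(fixed M b) -hN -iterD addnC iterD hM fixed.
Qed.

End Machine.

End KdTrees.

Lemma foldl_collect (K V : Type) (a : pred K) (f : K -> V) s0 s :
  foldl (fun acc x => if a x then f x :: acc else acc) s0 s =
  rev [seq f x | x <- s & a x] ++ s0.
Proof.
elim: s s0 => //= x s IH s0; rewrite IH; case: (a x) => //=.
by rewrite rev_cons cat_rcons.
Qed.

Lemma foldl_collect2 (K V : Type) (a b : pred K) (f : K -> V) s0 s1 s :
  foldl (fun acc x => if a x then (f x :: acc.1, acc.2)
                      else if b x then (acc.1, f x :: acc.2) else acc)
        (s0, s1) s =
  (rev [seq f x | x <- s & a x] ++ s0,
   rev [seq f x | x <- s & ~~ a x && b x] ++ s1).
Proof.
elim: s s0 s1 => //= x s IH s0 s1.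
case: (a x) => /=; first by rewrite IH /= rev_cons cat_rcons.
by case: (b x) => /=; rewrite IH //= rev_cons cat_rcons.
Qed.

(** * Aggregates over families of clusters *)

Section InstanceTheory.
Variables (R : realFieldType) (P : acr_instance R).

Notation tup := (acr_tup P).
Notation att := (@acr_a R P).
Notation op := (@acr_op R P).

Implicit Types (C S F A : {set tup}) (Cs full part : seq {set tup}).
Implicit Types (c : candidate P) (Q : cset P) (j : 'I_(acr_n P)).

Lemma bounds_within a C x : x \in C ->
  ((bounds a C).1 <= (acr_row x a)%:E <= (bounds a C).2)%E.
Proof. by move=> xC; rewrite /= bigmin_le_cond ?le_bigmax_cond. Qed.

Lemma bounds_set1 a (x : tup) :
  bounds a [set x] = ((acr_row x a)%:E, (acr_row x a)%:E).
Proof. by rewrite /bounds !big_set1. Qed.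

Section Tiled.
Variables (Cs : seq {set tup}) (S : {set tup}) (j : 'I_(acr_n P)).
Hypothesis tCs : tiles Cs S.

Lemma tiled_agg V (idx : V) (o : Monoid.com_law idx) g :
  \big[o/idx]_(C <- Cs) \big[o/idx]_(t in agg_sel j C) g t =
  \big[o/idx]_(t in agg_sel j S) g t.
Proof.
under eq_bigr do under eq_bigl do rewrite inE.
by rewrite (big_tiles _ _ _ tCs); apply: eq_bigl => t; rewrite inE.
Qed.

Lemma tiled_agg_cond V (idx : V) (o : Monoid.com_law idx) (p : pred tup) g :
  \big[o/idx]_(C <- Cs) \big[o/idx]_(t in agg_sel j C | p t) g t =
  \big[o/idx]_(t in agg_sel j S | p t) g t.
Proof.
under eq_bigr do under eq_bigl do rewrite inE -andbA.
by rewrite (big_tiles _ _ _ tCs); apply: eq_bigl => t; rewrite inE -andbA.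
Qed.

Lemma tiled_sum : (\sum_(C <- Cs) agg_sum j C)%E = agg_sum j S.
Proof. by rewrite sumEFin tiled_agg. Qed.

Lemma tiled_sum_neg : (\sum_(C <- Cs) agg_sum_neg j C)%E = agg_sum_neg j S.
Proof. by rewrite sumEFin tiled_agg_cond. Qed.

Lemma tiled_sum_pos : (\sum_(C <- Cs) agg_sum_pos j C)%E = agg_sum_pos j S.
Proof. by rewrite sumEFin tiled_agg_cond. Qed.

Lemma tiled_count : (\sum_(C <- Cs) agg_count j C)%E = agg_count j S.
Proof.
rewrite sumEFin; congr (_%:E); under eq_bigr do rewrite -sumr_const.
by rewrite tiled_agg sumr_const.
Qed.

Lemma tiled_min : \big[mine/+oo%E]_(C <- Cs) agg_min j C = agg_min j S.
Proof. exact: tiled_agg. Qed.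

Lemma tiled_max : \big[maxe/-oo%E]_(C <- Cs) agg_max j C = agg_max j S.
Proof. exact: tiled_agg. Qed.

Lemma agg_merge_tiled : agg_merge Cs j = agg_val j S.
Proof.
rewrite /agg_merge /agg_val; case: fa_fun.
- exact: tiled_count.
- exact: tiled_sum.
- exact: tiled_min.
- exact: tiled_max.
- by rewrite tiled_sum tiled_count.
Qed.

End Tiled.

(* The bounds of RP, as a function of the tuples surely ([F]) and possibly ([A])
   in the answer. *)
Definition set_sum_bounds j F A : \bar R * \bar R :=
  (agg_sum j F + agg_sum_neg j (A :\: F),
   agg_sum j F + agg_sum_pos j (A :\: F))%E.

Definition set_count_bounds j F A : \bar R * \bar R :=
  (agg_count j F, agg_count j A).

Definition set_bounds F A j : \bar R * \bar R :=
  match fa_fun (acr_agg j) with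
  | Count => set_count_bounds j F A
  | Sum => set_sum_bounds j F A
  | Min => (agg_min j A, agg_min j F)
  | Max => (agg_max j F, agg_max j A)
  | Avg => itv_div (set_sum_bounds j F A) (set_count_bounds j F A)
  end.

Lemma agg_bounds_tiled full part F A : F \subset A ->
  tiles full F -> tiles (full ++ part) A ->
  agg_bounds full part =1 set_bounds F A.
Proof.
move=> /subsetP FA tF tA j.
(* Subtracting the counts of [full] from those of [full ++ part] shows that the partial clusters
   tile the doubtful tuples. *)
have tD : tiles part (A :\: F).
  move=> x; have := tA x; rewrite count_cat tF inE.
  by have := FA x; case: (x \in F) => [/(_ isT) ->|_] /= => [[]|].
rewrite /agg_bounds /set_bounds /sum_bounds /count_bounds.
rewrite (tiled_count j tF) (tiled_count j tA) (tiled_sum j tF).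
rewrite (tiled_sum_neg j tD) (tiled_sum_pos j tD).
rewrite (tiled_min j tF) (tiled_min j tA).
by rewrite (tiled_max j tF) (tiled_max j tA).
Qed.

(** * Monotonicity of the aggregate bounds in the sure and possible tuples *)

Section Nested.
Variables (F F' A' A : {set tup}) (j : 'I_(acr_n P)).
Hypotheses (FF' : F \subset F') (FA' : F' \subset A') (AA' : A' \subset A).

Lemma agg_sel_sub C S : C \subset S -> agg_sel j C \subset agg_sel j S.
Proof.
by move=> /subsetP CS; apply/subsetP => t; rewrite !inE => /andP[/CS -> ->].
Qed.

Lemma agg_count_le C S : C \subset S -> (agg_count j C <= agg_count j S)%E.
Proof.
by move=> CS; rewrite lee_fin ler_nat subset_leq_card ?agg_sel_sub.
Qed.

Lemma agg_min_le C S : C \subset S -> (agg_min j S <= agg_min j C)%E.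
Proof.
move=> /agg_sel_sub /subsetP CS; apply: le_bigmin => [|t tC]; first exact: leey.
by apply: bigmin_le_cond; exact: CS.
Qed.

Lemma agg_max_le C S : C \subset S -> (agg_max j C <= agg_max j S)%E.
Proof.
move=> /agg_sel_sub /subsetP CS.
apply: bigmax_le => [|t tC]; first exact: leNye.
by apply: le_bigmax_cond; exact: CS.
Qed.

Lemma set_count_bounds_nested :
  nested (set_count_bounds j F' A') (set_count_bounds j F A).
Proof. by rewrite /nested /= !agg_count_le. Qed.

(** Among filtered tuples, the lower bound counts the value on [F], its negative part on [A :\: F]
    and 0 elsewhere, so settling a doubtful tuple either way can only raise it. The upper bound is
    symmetric. *)
Lemma set_sum_bounds_nested :
  nested (set_sum_bounds j F' A') (set_sum_bounds j F A).
Proof.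
rewrite /nested /= /agg_sum /agg_sum_neg /agg_sum_pos -!EFinD !lee_fin.
rewrite ![\sum_(t in agg_sel j _) _]big_mkcond.
rewrite ![\sum_(t in agg_sel j _ | _) _]big_mkcond -!big_split /=.
(* The chain of inclusions leaves five of the sixteen membership patterns; the sign of the value
   settles these. *)
apply/and3P; split; apply: ler_sum => t _; rewrite !inE;
  have := subsetP FF' t; have := subsetP FA' t; have := subsetP AA' t;
  case: (t \in F) (t \in F') (t \in A') (t \in A) => [] [] [] [] //=;
  try (by move=> /(_ isT)); try (by move=> _ /(_ isT));
  try (by move=> _ _ /(_ isT)); move=> _ _ _;
  case: (fa_cond _ _) => //=; rewrite ?addr0 ?add0r ?lexx //;
  by case: ltrgt0P => h; rewrite ?h ?lexx ?(ltW h).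
Qed.

Lemma set_bounds_nested : nested (set_bounds F' A' j) (set_bounds F A j).
Proof.
rewrite /set_bounds; case: fa_fun.
- exact: set_count_bounds_nested.
- exact: set_sum_bounds_nested.
- by rewrite /nested /= !agg_min_le.
- by rewrite /nested /= !agg_max_le.
(* Counts are nonnegative, so an average is always an admissible quotient, even when the least count
   is 0. *)
apply: itv_div_nested; [|exact: set_sum_bounds_nested
                        |exact: set_count_bounds_nested].
by rewrite /divisor_ok /= lee_fin ler0n.
Qed.

End Nested.

Lemma set_bounds_point S j : set_bounds S S j = (agg_val j S, agg_val j S).
Proof.
have e0 : agg_sel j set0 = set0 by apply/setP => t; rewrite !inE.
rewrite /set_bounds /agg_val /set_sum_bounds setDv.
rewrite /agg_sum_neg /agg_sum_pos e0.
rewrite ![\sum_(t in set0 | _) _]big_pred0 => [|t|t]; rewrite ?inE // !adde0.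
by case: fa_fun => //; rewrite /itv_div itv_corners_point.
Qed.

(** * Clusters selected by the two traversals *)

Section Traversals.
Variable root : kdtree tup.
Hypothesis root_kd : kd_tree_of root.

Lemma in_answer c t :
  (t \in answer c) =
  [forall i, cmp_eval (op i) (acr_row t (att i))%:E (c i)%:E].
Proof. by rewrite inE; apply: eq_forallb => i; rewrite cmp_eval_EFin. Qed.

Definition ff_in c (t : kdtree tup) : bool :=
  [forall i, eval_all (op i) (bounds (att i) (kd_cluster t)) (c i)%:E].

Definition ff_out c (t : kdtree tup) : bool :=
  [exists i,
     eval_all (cmp_neg (op i)) (bounds (att i) (kd_cluster t)) (c i)%:E].

(** An undecided leaf would push no children, so treating it as a stop changes nothing and makes
    every opened node an inner one. *)
Definition ff_descend c (t : kdtree tup) : bool :=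
  [&& ~~ ff_in c t, ~~ ff_out c t & ~~ kd_leaf t].

Lemma ff_clustersE c Cs : ff_clusters root c Cs <->
  Cs = rev [seq kd_cluster t | t <- terminals (ff_descend c) root & ff_in c t].
Proof.
pose upd (Cs : seq {set tup}) t := if ff_in c t then kd_cluster t :: Cs else Cs.
rewrite -[rev _]cats0 -(foldl_collect _ _ [::]).
apply: (@iter_visit _ (ff_descend c) _ _ pair upd) => [st a b [//]|//|t st a].
rewrite /ff_descend /upd /=; rewrite -/(ff_in c t) -/(ff_out c t).
case: (ff_in c t) => //=; case: (ff_out c t) => //=.
by rewrite /kd_leaf; case: t => C [].
Qed.

Lemma eval_all_cluster o a C x (v : R) : x \in C ->
  eval_all o (bounds a C) v%:E -> cmp_eval o (acr_row x a)%:E v%:E.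
Proof.
move=> xC; rewrite -reval_all_point; apply: reval_all_nested.
  by rewrite nested_point bounds_within.
exact: nested_diag.
Qed.

(** Accepted clusters lie inside the answer and rejected ones outside it; a leaf holds one tuple, on
    which the test is exact. *)
Lemma ff_clusters_tile c Cs : ff_clusters root c Cs -> tiles Cs (answer c).
Proof.
move=> /ff_clustersE ->; have [rootT root_wf] := root_kd.
apply: tiles_rev; rewrite -[answer c]setTI -rootT.
apply: tiles_terminals root_wf => [t /and3P[]//|t wft nt x xt].
have [int|nint] := boolP (ff_in c t).
  rewrite in_answer; symmetry; apply/forallP => i.
  exact: eval_all_cluster xt (forallP int i).
move: nt; rewrite /ff_descend nint /= negb_and !negbK.
case/orP => [/existsP[i outi]|lt].
  symmetry; apply/negbTE; rewrite in_answer negb_forall.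
  apply/existsP; exists i.
  by rewrite -cmp_eval_neg; exact: eval_all_cluster xt outi.
have [y ty] := kd_wf_leaf wft lt.
move: xt nint; rewrite /ff_in ty inE in_answer => /eqP -> /negbTE <-.
symmetry; apply: eq_forallb => i.
by rewrite bounds_set1 /eval_all reval_all_point.
Qed.

Lemma ff_clusters_exist c : exists Cs, ff_clusters root c Cs.
Proof.
by eexists; apply/ff_clustersE.
Qed.

(** The interval tests on a single row, whose attribute intervals are points; on leaf clusters the
    tests of RP reduce to these. *)
Definition surely Q : {set tup} :=
  [set x | [forall i, reval_all (op i)
             ((acr_row x (att i))%:E, (acr_row x (att i))%:E) (itvE (Q i))]].

Definition possibly Q : {set tup} :=
  [set x | [forall i, reval_ex (op i)
             ((acr_row x (att i))%:E, (acr_row x (att i))%:E) (itvE (Q i))]].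

Lemma mem_surely Q x : (x \in surely Q) =
  [forall i, reval_all (op i)
     ((acr_row x (att i))%:E, (acr_row x (att i))%:E) (itvE (Q i))].
Proof. by rewrite inE. Qed.

Lemma mem_possibly Q x : (x \in possibly Q) =
  [forall i, reval_ex (op i)
     ((acr_row x (att i))%:E, (acr_row x (att i))%:E) (itvE (Q i))].
Proof. by rewrite inE. Qed.

(** With reversed endpoints, a universal test can hold where the existential one fails, and sure
    tuples need not be possible. *)
Definition proper_cset Q : Prop := forall i, (Q i).1 <= (Q i).2.

Lemma surely_possibly Q : proper_cset Q -> surely Q \subset possibly Q.
Proof.
move=> pQ; apply/subsetP => x; rewrite !inE => /forallP h; apply/forallP => i.
by apply: reval_all_ex (h i) => //=; rewrite lee_fin.
Qed.

Definition rp_in Q (t : kdtree tup) : bool :=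
  [forall i, reval_all (op i) (bounds (att i) (kd_cluster t)) (itvE (Q i))].

Definition rp_pin Q (t : kdtree tup) : bool :=
  [forall i, reval_ex (op i) (bounds (att i) (kd_cluster t)) (itvE (Q i))].

Definition rp_descend Q (t : kdtree tup) : bool :=
  [&& ~~ rp_in Q t, rp_pin Q t & ~~ kd_leaf t].

Lemma rp_clustersE Q full part : rp_clusters root Q full part <->
  (full, part) =
  (rev [seq kd_cluster t | t <- terminals (rp_descend Q) root & rp_in Q t],
   rev [seq kd_cluster t | t <- terminals (rp_descend Q) root
                         & ~~ rp_in Q t && rp_pin Q t]).
Proof.
pose upd (acc : seq {set tup} * seq {set tup}) t :=
  if rp_in Q t then (kd_cluster t :: acc.1, acc.2)
  else if rp_pin Q t then (acc.1, kd_cluster t :: acc.2) else acc.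
pose mk (st : seq (kdtree tup)) (acc : seq {set tup} * seq {set tup}) :=
  (st, acc.1, acc.2).
have := foldl_collect2 (rp_in Q) (rp_pin Q) (@kd_cluster _) [::] [::]
          (terminals (rp_descend Q) root).
rewrite !cats0 => <-.
apply: (@iter_visit _ (rp_descend Q) _ _ mk upd (rp_visit Q) _ _ _ root
          ([::], [::]) (full, part)).
- by move=> st [a1 a2] [b1 b2] [-> ->].
- by case.
move=> t st [a1 a2]; rewrite /rp_descend /upd /mk /=.
rewrite -/(rp_in Q t) -/(rp_pin Q t).
by case: (rp_in Q t); case: (rp_pin Q t); case: (kd_leaf t).
Qed.

Lemma rp_clusters_exist Q : exists full part, rp_clusters root Q full part.
Proof. by do 2 eexists; apply/rp_clustersE. Qed.

(** The same stopping points are filtered twice: by [rp_in] for the sure tuples, by [rp_in] or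
    [rp_pin] for the possible ones. *)
Lemma rp_clusters_tile Q full part : proper_cset Q ->
  rp_clusters root Q full part ->
  tiles full (surely Q) /\ tiles (full ++ part) (possibly Q).
Proof.
move=> pQ /rp_clustersE[-> ->]; have [rootT root_wf] := root_kd.
have nQ i : nested (itvE (Q i)) (itvE (Q i)).
  by apply: nested_refl; rewrite lee_fin.
have in_surely t x : x \in kd_cluster t -> rp_in Q t -> x \in surely Q.
  move=> xt /forallP int; rewrite inE; apply/forallP => i.
  apply: reval_all_nested (int i) => //.
  by rewrite nested_point bounds_within.
have pin_possibly t x : x \in kd_cluster t -> x \in possibly Q -> rp_pin Q t.
  move=> xt; rewrite inE => /forallP pos; apply/forallP => i.
  apply: reval_ex_nested (pos i) => //.
  by rewrite nested_point bounds_within.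
have SP x : x \in surely Q -> x \in possibly Q.
  exact/subsetP/surely_possibly.
have inner t : rp_descend Q t -> ~~ kd_leaf t by case/and3P.
have leafE t x : kd_wf t -> kd_leaf t -> x \in kd_cluster t ->
    (rp_in Q t = (x \in surely Q)) * (rp_pin Q t = (x \in possibly Q)).
  move=> wft lt; have [y ty] := kd_wf_leaf wft lt.
  rewrite ty inE => /eqP ->; rewrite /rp_in /rp_pin ty !inE.
  by split; apply: eq_forallb => i; rewrite bounds_set1.
have possE t : kd_wf t -> ~~ rp_descend Q t -> forall x, x \in kd_cluster t ->
    rp_in Q t || rp_pin Q t = (x \in possibly Q).
  move=> wft nt x xt; have [int|nint] := boolP (rp_in Q t).
    by symmetry; apply: SP; exact: in_surely int.
  move: nt; rewrite /rp_descend nint /=.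
  have [pint|npint] := boolP (rp_pin Q t).
    by rewrite negbK => lt; rewrite -(leafE t x wft lt xt).2.
  move=> _; symmetry; apply: contraNF npint; exact: pin_possibly.
have surE t : kd_wf t -> ~~ rp_descend Q t -> forall x, x \in kd_cluster t ->
    rp_in Q t = (x \in surely Q).
  move=> wft nt x xt; have [int|nint] := boolP (rp_in Q t).
    by symmetry; exact: in_surely int.
  (* A cluster with a sure tuple passes [rp_pin]; if it also fails [rp_in], the traversal can stop
     there only at a leaf, where the test is exact. *)
  apply/esym/negbTE; apply: contra nint => xS.
  move: (nt); rewrite /rp_descend (pin_possibly _ _ xt (SP _ xS)) /=.
  by rewrite negb_and !negbK => /orP[//|lt]; rewrite (leafE t x wft lt xt).1.
rewrite -[surely Q]setTI -[possibly Q]setTI -rootT; split.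
  exact/tiles_rev/tiles_terminals.
(* Concatenating the two lists differs from filtering by the disjunction only in order, which
   counting ignores. *)
move=> x; rewrite -(tiles_terminals inner possE root_wf) count_cat !count_rev.
elim: (terminals _ _) => //= t ts IH.
case: (rp_in Q t) => /=; first by rewrite -IH addnA.
by case: (rp_pin Q t) => //=; rewrite -IH addnCA.
Qed.

End Traversals.

(** * Sorted enumerations of candidates *)

Lemma leq_dist_trans : transitive (fun c c' => dist c <= dist c').
Proof. by move=> b a c; exact: le_trans. Qed.

(** In a sorted enumeration, everything dropped is at least as far as everything kept. *)
Lemma k_closest_take (A : pred (candidate P)) s : uniq s -> s =i A ->
  sorted (fun c c' => dist c <= dist c') s -> k_closest A (take (acr_k P) s).
Proof.
move=> us sA ss; split.
- exact: take_uniq.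
- by apply/allP => c /mem_take; rewrite sA.
- by rewrite size_take_min geq_minl.
- rewrite size_take_min gtn_min ltnn /= => lts c Ac.
  by rewrite (take_oversize (ltnW lts)) sA.
move=> c c' ct Ac' nc'.
have : c' \in drop (acr_k P) s.
  have : c' \in s by rewrite sA.
  by rewrite -{1}(cat_take_drop (acr_k P) s) mem_cat (negbTE nc').
move: ss; rewrite (sorted_pairwise leq_dist_trans).
rewrite -{1}(cat_take_drop (acr_k P) s) pairwise_cat => /and3P[/allrelP h _ _].
exact: h.
Qed.

(** * Full cluster filtering *)

Section FullClusterFilteringCorrect.
Variable root : kdtree tup.
Hypothesis root_kd : kd_tree_of root.

Lemma constraint_ff_clusters c Cs : ff_clusters root c Cs ->
  constraint (agg_merge Cs) = constraint (fun j => agg_val j (answer c)).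
Proof.
move=> /(ff_clusters_tile root_kd) tCs; rewrite /constraint; congr cmp_eval.
by apply: eq_aexpr_eval => j; exact: agg_merge_tiled.
Qed.

Lemma ff_computes cs : ff_order cs ->
  computes (@ff_step R P root) (@ff_halt R P) (@solution R P) (cs, [::]).
Proof.
move=> [ucs csE scs].
have closest : solution (take (acr_k P) (filter (@is_repair R P) cs)).
  apply: k_closest_take.
  - exact: filter_uniq.
  - by move=> c; rewrite mem_filter csE andb_idr // => /andP[].
  - exact: (sorted_filter leq_dist_trans (@is_repair R P) scs).
(* Loop invariant: the output followed by the repairs still to be tried is the sorted list of all
   repairs, so the output is always a prefix of it. *)
suff gen todo out : {subset todo <= @is_candidate R P} ->
    (size out <= acr_k P)%N ->
    filter (@is_repair R P) cs = out ++ filter (@is_repair R P) todo ->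
    computes (@ff_step R P root) (@ff_halt R P) (@solution R P) (todo, out).
  by apply: gen => // c; rewrite csE.
elim: todo out => [|c todo IH] out cand le_k outE.
  split; first by right; exists out; constructor.
    move=> o ho.
    suff -> : o = take (acr_k P) (filter (@is_repair R P) cs) by [].
    rewrite outE cats0 take_oversize //.
    by inversion ho.
  by move=> s' st; inversion st.
have [lt_k|ge_k] := ltnP (size out) (acr_k P); last first.
  split; first by right; exists out; exact: FFEnough.
    move=> o ho.
    suff -> : o = take (acr_k P) (filter (@is_repair R P) cs) by [].
    have <- : out = o by inversion ho.
    have sz : size out = acr_k P by apply/eqP; rewrite eqn_leq le_k.
    by rewrite outE -sz take_size_cat.
  by move=> s' st; inversion st as [? ? ? ? lt_k]; rewrite ltnNge ge_k in lt_k.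
split.
- have [Cs hCs] := ff_clusters_exist root c.
  by left; eexists; exact: FFStep hCs.
- move=> o ho; inversion ho as [|? ? ge_k]; subst.
  by rewrite ltnNge ge_k in lt_k.
move=> s' st; inversion st as [c0 cs0 out0 Cs _ hCs]; subst.
rewrite (constraint_ff_clusters hCs).
have cc : is_candidate c by apply: cand; rewrite mem_head.
have rE : constraint (fun j => agg_val j (answer c)) = is_repair c.
  by rewrite /is_repair cc.
apply: IH.
- by move=> d dt; apply: cand; rewrite inE dt orbT.
- by case: ifP => _; rewrite ?size_rcons.
by rewrite outE /= -rE; case: ifP => // _; rewrite cat_rcons.
Qed.

End FullClusterFilteringCorrect.

(** * Bounds of candidate sets *)

Definition sub_cset Q' Q : Prop := forall i, nested (Q' i) (Q i).

Definition point_cset c : cset P := [ffun i => (c i, c i)].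

Definition cset_bounds Q j : \bar R * \bar R :=
  set_bounds (surely Q) (possibly Q) j.

Lemma itvE_nested (I J : R * R) : nested (itvE I) (itvE J) = nested I J.
Proof. by rewrite /nested !lee_fin. Qed.

Lemma point_cset_sub Q c : in_cset Q c -> sub_cset (point_cset c) Q.
Proof. by move=> /forallP h i; rewrite ffunE nested_point; exact: h. Qed.

Lemma surely_point c : surely (point_cset c) = answer c.
Proof.
apply/setP => x; rewrite in_answer inE; apply: eq_forallb => i.
by rewrite ffunE reval_all_point.
Qed.

Lemma possibly_point c : possibly (point_cset c) = answer c.
Proof.
apply/setP => x; rewrite in_answer inE; apply: eq_forallb => i.
by rewrite ffunE reval_ex_point.
Qed.

Lemma surely_anti Q Q' : sub_cset Q' Q -> surely Q \subset surely Q'.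
Proof.
move=> sub; apply/subsetP => x xQ; rewrite mem_surely; apply/forallP => i.
move: xQ; rewrite mem_surely => /forallP h.
by apply: reval_all_nested (h i); [exact: nested_diag | rewrite itvE_nested].
Qed.

Lemma possibly_mono Q Q' : sub_cset Q' Q -> possibly Q' \subset possibly Q.
Proof.
move=> sub; apply/subsetP => x xQ; rewrite mem_possibly; apply/forallP => i.
move: xQ; rewrite mem_possibly => /forallP h.
by apply: reval_ex_nested (h i); [exact: nested_diag | rewrite itvE_nested].
Qed.

(** Narrowing [Q] enlarges the sure tuples and shrinks the possible ones, the chain that
    [set_bounds_nested] requires. *)
Lemma cset_bounds_nested Q Q' j :
  sub_cset Q' Q -> nested (cset_bounds Q' j) (cset_bounds Q j).
Proof.
move=> sub.
apply: set_bounds_nested; [exact: surely_anti | | exact: possibly_mono].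
by apply: surely_possibly => i; case/and3P: (sub i).
Qed.

Lemma cset_bounds_point c j :
  cset_bounds (point_cset c) j = (agg_val j (answer c), agg_val j (answer c)).
Proof.
by rewrite /cset_bounds surely_point possibly_point set_bounds_point.
Qed.

(** * Cluster range pruning *)

Section ClusterRangePruningCorrect.
Variable root : kdtree tup.
Hypothesis root_kd : kd_tree_of root.
Variables (p : nat) (split : 'I_(acr_m P) -> R * R -> p.-tuple (R * R)).
Variable dlow : cset P -> R.
Hypothesis splitP : is_split split.
Hypothesis dlowP : dist_lower_bound dlow.
Hypothesis rootok : rp_divisors_ok root.

(** Kept for every queued set, because [is_split] constrains only the splitting of such
    intervals. *)
Definition data_cset Q : Prop := forall i,
  [/\ (Q i).1 \in adom (att i), (Q i).2 \in adom (att i) & (Q i).1 <= (Q i).2].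

Lemma data_cset_proper Q : data_cset Q -> proper_cset Q.
Proof. by move=> dQ i; case: (dQ i). Qed.

Lemma tup_nonempty : exists x : tup, x \in [set: tup].
Proof. by have [<- /kd_wf_nonempty] := root_kd. Qed.

(** Over a nonempty relation the minimum and maximum are attained, so [fine] meets no infinity and
    the endpoints are data values. *)
Lemma data_cset_root : data_cset (cset_root P).
Proof.
have [x0 x0T] := tup_nonempty => i; rewrite ffunE /=.
have [x _ xmin] := eq_bigmin x0 (mem [set: tup])
    (fun t : tup => (acr_row t (att i))%:E) x0T (fun t _ => leey _).
have [y _ ymax] := eq_bigmax x0 (mem [set: tup])
    (fun t : tup => (acr_row t (att i))%:E) x0T (fun t _ => leNye _).
have /andP[h1 h2] := bounds_within (att i) x0T; have := le_trans h1 h2.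
by rewrite /= xmin ymax /= lee_fin => ->; split; rewrite // map_f ?mem_enum.
Qed.

Lemma adom_root i x : x \in adom (att i) -> Defs.in_itv (cset_root P i) x.
Proof.
have [ax ay _] := data_cset_root i.
move=> /imageP[t _ ->]; rewrite /Defs.in_itv -!lee_fin.
have := bounds_within (att i) (in_setT t).
move: (in_setT t) ax ay; rewrite ffunE /= => tT ax ay.
have [x0 _ xmin] := eq_bigmin t (mem [set: tup])
    (fun t : tup => (acr_row t (att i))%:E) tT (fun t _ => leey _).
have [y _ ymax] := eq_bigmax t (mem [set: tup])
    (fun t : tup => (acr_row t (att i))%:E) tT (fun t _ => leNye _).
by rewrite xmin ymax.
Qed.

Lemma data_cset_sub_root Q : data_cset Q -> sub_cset Q (cset_root P).
Proof.
move=> dQ i; have [/adom_root/andP[h1 _] /adom_root/andP[_ h3] h2] := dQ i.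
exact/and3P.
Qed.

Lemma agg_bounds_cset Q full part : data_cset Q ->
  rp_clusters root Q full part -> agg_bounds full part =1 cset_bounds Q.
Proof.
move=> /data_cset_proper pQ /(rp_clusters_tile root_kd pQ)[tS tP].
by apply: agg_bounds_tiled => //; exact: surely_possibly.
Qed.

(** The assumption on divisors concerns the root set only; every other set lies within it, and the
    condition is inherited. *)
Lemma divisors_ok_cset Q :
  data_cset Q -> divisors_ok (cset_bounds Q) (acr_phi P).
Proof.
move=> dQ; have [full [part fp]] := rp_clusters_exist root (cset_root P).
have ok : divisors_ok (cset_bounds (cset_root P)) (acr_phi P).
  by rewrite -(eq_divisors_ok _ (agg_bounds_cset data_cset_root fp)) rootok.
have nQ j := cset_bounds_nested j (data_cset_sub_root dQ).
by have [] := aexpr_bounds_nested nQ ok.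
Qed.

(** * Soundness of the constraint tests *)

Definition phi_val c : \bar R :=
  aexpr_eval (fun j => agg_val j (answer c)) (acr_phi P).

Section Tests.
Variables (Q : cset P) (full part : seq {set tup}).
Hypotheses (dQ : data_cset Q) (fp : rp_clusters root Q full part).

(** A candidate is a degenerate subset of [Q], where the bounds are exact; monotonicity does the
    rest. *)
Lemma phi_val_within c : in_cset Q c ->
  nested (phi_val c, phi_val c) (phi_bounds full part).
Proof.
move=> cQ; rewrite /phi_bounds (eq_aexpr_bounds _ (agg_bounds_cset dQ fp)).
have nQ j :
    nested (agg_val j (answer c), agg_val j (answer c)) (cset_bounds Q j).
  by rewrite -cset_bounds_point; exact/cset_bounds_nested/point_cset_sub.
have [] := aexpr_bounds_nested nQ (divisors_ok_cset dQ).
by rewrite aexpr_bounds_point.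
Qed.

Lemma aceval_all_sound c : in_cset Q c -> aceval_all full part ->
  constraint (fun j => agg_val j (answer c)).
Proof.
move=> /phi_val_within nv; rewrite /constraint -reval_all_point.
by apply: reval_all_nested nv; exact: nested_diag.
Qed.

Lemma aceval_ex_complete c : in_cset Q c ->
  constraint (fun j => agg_val j (answer c)) -> aceval_ex full part.
Proof.
move=> /phi_val_within nv; rewrite /constraint -reval_ex_point.
by apply: reval_ex_nested nv; exact: nested_diag.
Qed.

(** Both tests become the comparison of two numbers, so a degenerate set is accepted or discarded,
    never divided. *)
Lemma aceval_point : (forall i, (Q i).1 = (Q i).2) ->
  aceval_ex full part = aceval_all full part.
Proof.
move=> Q12; have QE : Q = point_cset [ffun i => (Q i).1].
  by apply/ffunP => i; rewrite !ffunE {2}Q12 -surjective_pairing.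
rewrite /aceval_ex /aceval_all /phi_bounds.
rewrite (eq_aexpr_bounds _ (agg_bounds_cset dQ fp)) QE.
rewrite (eq_aexpr_bounds _ (cset_bounds_point _)) aexpr_bounds_point.
by rewrite reval_ex_point reval_all_point.
Qed.

End Tests.

(* Division terminates because it strictly decreases this measure. *)
Definition cset_size Q : nat :=
  \sum_i #|[set t : tup | Defs.in_itv (Q i) (acr_row t (att i))]|.

(** Choose in each coordinate the fragment holding [c i]; the data filter keeps the result, as [c i]
    is a data value. *)
Lemma divide_cover Q c : data_cset Q -> is_candidate c -> in_cset Q c ->
  has ((@in_cset R P)^~ c) [seq Q' <- divide split Q | cset_has_data Q'].
Proof.
move=> dQ /forallP cc /forallP cQ.
have piece i : exists k, Defs.in_itv (tnth (split i (Q i)) k) (c i).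
  have [q1 q2 le12] := dQ i; have [count_eq _ _] := splitP q1 q2 le12.
  have : has (fun J => Defs.in_itv J (c i)) (split i (Q i)).
    by rewrite has_count count_eq // cQ.
  by case/hasP => J /tnthP[k ->]; exists k.
have [f fP] := fin_all_exists piece.
apply/hasP; exists [ffun i => tnth (split i (Q i)) ([ffun i => f i] i)].
  rewrite mem_filter; apply/andP; split; last exact: codom_f.
  by apply/forallP => i; apply/hasP; exists (c i); rewrite ?cc // !ffunE.
by apply/forallP => i; rewrite !ffunE.
Qed.

Section Piece.
Variables (Q Q' : cset P).
Hypotheses (dQ : data_cset Q) (Q'Q : Q' \in divide split Q).
Hypothesis Q'data : cset_has_data Q'.

Lemma divide_piece i : Q' i \in split i (Q i).
Proof. by have /codomP[f ->] := Q'Q; rewrite ffunE mem_tnth. Qed.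

Lemma divide_data : data_cset Q'.
Proof.
move=> i; have [q1 q2 le12] := dQ i; have [_ ends _] := splitP q1 q2 le12.
have hi := forallP Q'data i; have [e1 e2] := ends _ (divide_piece i) hi.
by split=> //; have /hasP[x _ /andP[]] := hi; exact: le_trans.
Qed.

Lemma divide_sub i x : x \in adom (att i) ->
  Defs.in_itv (Q' i) x -> Defs.in_itv (Q i) x.
Proof.
move=> xa xQ'; have [q1 q2 le12] := dQ i.
have [count_eq _ _] := splitP q1 q2 le12.
have : has (fun J => Defs.in_itv J x) (split i (Q i)).
  by apply/hasP; exists (Q' i); first exact: divide_piece.
by rewrite has_count count_eq //; case: (Defs.in_itv _ _).
Qed.

(** No coordinate gains a tuple; where the endpoints differ, [is_split] names a data value missing
    from the fragment, and a tuple carrying it is lost. *)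
Lemma divide_size : (exists i, (Q i).1 != (Q i).2) ->
  (cset_size Q' < cset_size Q)%N.
Proof.
have sub i : [set t : tup | Defs.in_itv (Q' i) (acr_row t (att i))] \subset
             [set t : tup | Defs.in_itv (Q i) (acr_row t (att i))].
  apply/subsetP => t; rewrite !inE; apply: divide_sub.
  by rewrite map_f ?mem_enum.
case=> i ne12; rewrite /cset_size (bigD1 i) //= [X in (_ < X)%N](bigD1 i) //=.
rewrite -addSn leq_add ?leq_sum // => [|k _]; last exact: subset_leq_card.
have [q1 q2 le12] := dQ i; have [_ _ lose] := splitP q1 q2 le12.
have [|x /imageP[t _ ->] /andP[tQ tQ']] := lose _ _ (divide_piece i).
  by rewrite lt_neqAle ne12.
apply: proper_card; rewrite properE sub; apply/subsetPn; exists t.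
  by rewrite inE.
by rewrite inE.
Qed.

End Piece.

(** With B the number of choices of fragments, at most B pieces of smaller size weigh less in base B
    + 1 than the set they replace. Every set weighs at least 1, so removals decrease the weight
    too. *)
Definition queue_weight (q : seq (cset P)) : nat :=
  \sum_(Q <- q) #|{ffun 'I_(acr_m P) -> 'I_p}|.+1 ^ cset_size Q.

Lemma queue_weight_divide Q (new : seq (cset P)) :
  (size new <= #|{ffun 'I_(acr_m P) -> 'I_p}|)%N ->
  (forall Q', Q' \in new -> cset_size Q' < cset_size Q)%N ->
  (queue_weight new < #|{ffun 'I_(acr_m P) -> 'I_p}|.+1 ^ cset_size Q)%N.
Proof.
rewrite /queue_weight; set B := #|_| => size_new lt_new.
(* At size 0 nothing can be smaller, so there are no pieces. *)
case: (cset_size Q) lt_new => [|k] lt_new.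
  case: new lt_new {size_new} => [|Q' new] lt_new; first by rewrite big_nil.
  by have := lt_new Q' (mem_head _ _).
have : (\sum_(Q' <- new) B.+1 ^ cset_size Q' <= size new * B.+1 ^ k)%N.
  rewrite -sum1_size big_distrl /= big_seq [X in (_ <= X)%N]big_seq.
  apply: leq_sum => Q' /lt_new; rewrite ltnS mul1n; exact: leq_pexp2l.
move=> /leq_ltn_trans; apply.
by rewrite expnS ltn_pmul2r ?expn_gt0.
Qed.

(** Only repairs are ever accepted, and no repair is lost: it is accepted or still queued.
    Sortedness is what justifies the early exit. *)
Record rp_invariant (q rcand : seq (cset P)) : Prop := RPInvariant {
  inv_sorted : sorted (fun Q Q' => dlow Q <= dlow Q') q;
  inv_data : forall Q, Q \in q -> data_cset Q;
  inv_sound : forall c, is_candidate c ->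
    has ((@in_cset R P)^~ c) rcand -> is_repair c;
  inv_complete : forall c, is_repair c ->
    has ((@in_cset R P)^~ c) rcand || has ((@in_cset R P)^~ c) q
}.

Lemma rp_process_invariant Q q rcand q' rcand' :
  rp_invariant (Q :: q) rcand ->
  rp_process root split dlow Q q rcand q' rcand' ->
  rp_invariant q' rcand' /\ (queue_weight q' < queue_weight (Q :: q))%N.
Proof.
move=> [sq dq sound complete].
have dQ : data_cset Q by apply: dq; rewrite mem_head.
have dq0 Q' : Q' \in q -> data_cset Q'.
  by move=> Q'q; apply: dq; rewrite inE Q'q orbT.
have sq0 := path_sorted sq.
have wQ : (queue_weight q < queue_weight (Q :: q))%N.
  by rewrite /queue_weight big_cons -[X in (X < _)%N]add0n ltn_add2r expn_gt0.
case=> [full part fp all_ok|full part q1 fp nall ex [perm_q sorted_q]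
       |full part fp nall nex].
- split=> //; split=> // c.
    move=> cc /= /orP[cQ|]; last exact: sound.
    by rewrite /is_repair cc (aceval_all_sound dQ fp cQ).
  by move=> /complete /=; rewrite orbA [_ || in_cset Q c]orbC.
(* Were all intervals degenerate, the two tests would agree, yet here they differ. *)
- have multi : exists i, (Q i).1 != (Q i).2.
    apply/existsP; apply: contraNT nall; rewrite negb_exists => /forallP Q12.
    rewrite -(aceval_point dQ fp) // => i; apply/eqP.
    by have := Q12 i; rewrite negbK.
  split; last first.
    rewrite /queue_weight (perm_big _ perm_q) big_cat big_cons /=.
    rewrite addnC ltn_add2r.
    apply: queue_weight_divide => [|Q'].
      by rewrite size_filter (leq_trans (count_size _ _)) // size_image.
    by rewrite mem_filter => /andP[Q'data Q'Q]; exact: divide_size.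
  split=> // [Q'|c rc].
    rewrite (perm_mem perm_q) mem_cat => /orP[/dq0 //|].
    by rewrite mem_filter => /andP[Q'data Q'Q]; exact: divide_data Q'Q _.
  rewrite (perm_has _ perm_q) has_cat.
  have /= := complete _ rc; case: (has _ rcand) => //= /orP[cQ|-> //].
  by have /andP[cc _] := rc; rewrite divide_cover ?orbT.
split=> //; split=> // c rc.
have /= := complete _ rc; case: (has _ rcand) => //= /orP[cQ|//].
by have /andP[_ /(aceval_ex_complete dQ fp cQ)] := rc; rewrite (negbTE nex).
Qed.

Lemma rp_process_exists Q q rcand :
  exists q' rcand', rp_process root split dlow Q q rcand q' rcand'.
Proof.
have [full [part fp]] := rp_clusters_exist root Q.
have [all_ok|nall] := boolP (aceval_all full part).
  by do 2 eexists; exact: RPAccept fp all_ok.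
have [ex|nex] := boolP (aceval_ex full part); last first.
  by do 2 eexists; exact: RPDiscard fp nall nex.
pose new := [seq Q' <- divide split Q | cset_has_data Q'].
exists (sort (fun Q Q' => dlow Q <= dlow Q') (q ++ new)), rcand.
apply: RPDivide fp nall ex _; split; first by rewrite perm_sort.
by apply: sort_sorted => Q1 Q2; exact: le_total.
Qed.

(** Constants range over an infinite field; choosing for each condition a tuple to supply the
    constant gives a finite enumeration. *)
Definition all_candidates : seq (candidate P) :=
  undup [seq [ffun i => acr_row (f i) (att i)]
        | f : {ffun 'I_(acr_m P) -> tup}].

Lemma mem_all_candidates c : (c \in all_candidates) = is_candidate c.
Proof.
rewrite mem_undup; apply/codomP/forallP => [[f ->] i|cc].
  by rewrite ffunE map_f ?mem_enum.
have row i : exists t : tup, acr_row t (att i) = c i.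
  by have /imageP[t _ ->] := cc i; exists t.
have [f fP] := fin_all_exists row.
by exists [ffun i => f i]; apply/ffunP => i; rewrite !ffunE fP.
Qed.

Lemma rp_top_k_exists rcand :
  exists top : seq (candidate P), rp_top_k rcand top.
Proof.
pose A c := is_candidate c && has ((@in_cset R P)^~ c) rcand.
pose s := sort (fun c c' => dist c <= dist c') (filter A all_candidates).
have ss : sorted (fun c c' => dist c <= dist c') s.
  by apply: sort_sorted => c c'; exact: le_total.
exists (take (acr_k P) s); split; last exact: take_sorted.
apply: k_closest_take => // [|c].
  by rewrite sort_uniq filter_uniq ?undup_uniq.
by rewrite mem_sort mem_filter mem_all_candidates andb_idr // => /andP[].
Qed.

Lemma solution_exhausted rcand top :
  rp_invariant [::] rcand -> rp_top_k rcand top -> solution top.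
Proof.
move=> [_ _ sound complete] [[utop Atop le_k few close] _]; split=> //.
- by apply/allP => c /(allP Atop)/andP[]; exact: sound.
- move=> lt_k c rc; apply: few => //; have /andP[-> _] := rc.
  by have := complete _ rc; rewrite orbF.
move=> c c' ct rc'; apply: close => //; have /andP[-> _] := rc'.
by have := complete _ rc'; rewrite orbF.
Qed.

Lemma solution_leave q rcand top :
  rp_invariant q rcand -> rp_top_k rcand top -> rp_leave dlow q top ->
  solution top.
Proof.
case: q => // Qn q inv [[utop Atop le_k few close] stop] /andP[ge_k lt_low].
have [sq dq sound complete] := inv.
have sz : size top = acr_k P by apply/eqP; rewrite eqn_leq le_k.
split=> //.
- by apply/allP => c /(allP Atop)/andP[]; exact: sound.
- by rewrite sz ltnn.
move=> c c' ct rc' nc'; have /andP[cc' _] := rc'.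
have /orP[c'r|c'q] := complete _ rc'.
  by apply: close => //; rewrite cc'.
(* The k-th distance dominates in the sorted list; [c] itself witnesses k > 0, so the index k - 1 is
   not truncated. *)
have le_last : dist c <= nth 0 (map (@dist R P) top) (acr_k P).-1.
  have st : sorted <=%R (map (@dist R P) top) by rewrite sorted_map.
  have /(nthP 0)[n lt_n <-] : dist c \in map (@dist R P) top by rewrite map_f.
  rewrite size_map sz in lt_n.
  have k0 : (0 < acr_k P)%N by exact: leq_ltn_trans lt_n.
  apply: (sorted_leq_nth le_trans lexx 0 st); rewrite ?inE ?size_map ?sz //.
    by rewrite prednK.
  by rewrite -ltnS prednK.
apply: (le_trans le_last); apply: (le_trans (ltW lt_low)).
(* The set holding [c'] is the head of the queue or comes after it, so the head's lower bound is
   also one for [c']. *)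
have /hasP[Q Qq c'Q] := c'q; apply: le_trans (dlowP cc' c'Q).
have tr : transitive (fun Q Q' : cset P => dlow Q <= dlow Q').
  by move=> Q2 Q1 Q3; exact: le_trans.
move: Qq; rewrite inE => /predU1P[->//|Qq].
by move: sq; rewrite /= (path_sortedE tr) => /andP[/allP/(_ _ Qq)].
Qed.

(** Induction on the queue weight. The hypothesis on [top] serves the halt on an empty queue, which
    outputs the stored list. *)
Lemma rp_computes_from q rcand top :
  rp_invariant q rcand -> rp_top_k rcand top ->
  computes (rp_step root split dlow) (rp_halt root split dlow) (@solution R P)
    (q, rcand, top).
Proof.
have [n] := ubnP (queue_weight q); elim: n q rcand top => [q|n IH q] rcand top.
  by rewrite ltn0.
rewrite ltnS => le_n inv topk; split.
- case: q inv {le_n} => [|Q q] inv; first by right; exists top; exact: RPEmpty.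
  have [q' [rcand' proc]] := rp_process_exists Q q rcand.
  have [top' topk'] := rp_top_k_exists rcand'.
  have [lv|nlv] := boolP (rp_leave dlow q' top').
    by right; exists top'; exact: RPLeave proc topk' lv.
  by left; exists (q', rcand', top'); exact: RPStep proc topk' nlv.
- move=> o ho.
  inversion ho as [rc tp|Q q0 rc tp q' rcand' top' proc topk' lv]; subst.
    exact: solution_exhausted inv topk.
  have [inv' _] := rp_process_invariant inv proc.
  exact: solution_leave inv' topk' lv.
move=> s' st; inversion st as [Q q0 rc tp q' rcand' top' proc topk' nlv]; subst.
have [inv' lt_w] := rp_process_invariant inv proc.
by apply: IH => //; exact: leq_trans lt_w le_n.
Qed.

Lemma rp_computes :
  computes (rp_step root split dlow) (rp_halt root split dlow) (@solution R P)
    (rp_init P).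
Proof.
apply: rp_computes_from.
  split=> // [Q|c /andP[/forallP cc _]].
  - by rewrite inE => /eqP ->; exact: data_cset_root.
  - by rewrite /= orbF; apply/forallP => i; exact/adom_root/cc.
(* Nothing has been accepted yet, so the empty list is a valid top-k. *)
by do 2 split=> //; move=> _ c /andP[].
Qed.

End ClusterRangePruningCorrect.

End InstanceTheory.

Theorem theorem4p1 (R : realFieldType) (P : acr_instance R)
    (root : kdtree (acr_tup P)) (root_kd : kd_tree_of root) :
  (forall cs : seq (candidate P), ff_order cs ->
     computes (@ff_step R P root) (@ff_halt R P) (@solution R P) (cs, [::]))
  /\
  (forall (p : nat) (split : 'I_(acr_m P) -> R * R -> p.-tuple (R * R))
      (dlow : cset P -> R),
     is_split split -> dist_lower_bound dlow -> rp_divisors_ok root ->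
     computes (rp_step root split dlow) (rp_halt root split dlow)
       (@solution R P) (rp_init P)).
Proof.
split=> [cs csP|p split dlow splitP dlowP rootok]; first exact: ff_computes.
exact: rp_computes.
Qed.
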